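(* For every $\delta>0$ there exist constants $C_1=C_1(\mu,\delta)>0$ and $C_2=C_2(\mu,\delta)>0$ such that the following holds. Let $(\mathbf r,\mathbf c)$ be an $m\times n$ $\delta$-tame margin with an MLE $(\boldsymbol\alpha,\boldsymbol\beta)$, let $\rho\ge0$ be such that $\mu^{\otimes(m\times n)}(\mathcal T_\rho(\mathbf r,\mathbf c))\in(0,\infty)$, let $X\sim\lambda_{\mathbf r,\mathbf c,\rho}$ and $Y\sim\mu_{\boldsymbol\alpha\oplus\boldsymbol\beta}$. Then for each Borel set $\mathcal E\subseteq\mathbb R^{m\times n}$, $$\mathbb P(X\in\mathcal E)\le\exp(C_1\rho)\,\mathbb P(Y\in\mathcal T_\rho(\mathbf r,\mathbf c))^{-1}\,\mathbb P(Y\in\mathcal E).$$ Furthermore, if $\rho\ge C_2\sqrt{mn(m+n)}$ and $m,n\ge C_2$, then $$\mathbb P(X\in\mathcal E)\le2\exp(C_1\rho)\,\mathbb P(Y\in\mathcal E).$$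
   Context: Let $\mu$ be a $\sigma$-finite Borel measure on $\mathbb R$, $A=\inf\operatorname{supp}\mu$, $B=\sup\operatorname{supp}\mu$ (possibly infinite). Let $\Theta=\{\theta\in\mathbb R:\int e^{\theta x}\mu(dx)<\infty\}$, assumed nonempty and not a singleton, with interior $\Theta^\circ$; $\psi(\theta)=\log\int e^{\theta x}\mu(dx)$; for $\theta\in\Theta^\circ$, $\mu_\theta(dx)=e^{\theta x-\psi(\theta)}\mu(dx)$. Standing assumption: $\psi''>0$ on $\Theta^\circ$ and $\psi':\Theta^\circ\to(A,B)$ is a bijection. An $m\times n$ margin is a pair $(\mathbf r,\mathbf c)\in\mathbb R^m\times\mathbb R^n$. For a matrix $\mathbf x$, $r(\mathbf x)$ and $c(\mathbf x)$ are its vectors of row sums and column sums. For $\rho\ge0$, $\mathcal T_\rho(\mathbf r,\mathbf c)=\{\mathbf x\in\mathbb R^{m\times n}:\|r(\mathbf x)-\mathbf r\|_1\le\rho,\ \|c(\mathbf x)-\mathbf c\|_1\le\rho\}$. When $\mu^{\otimes(m\times n)}(\mathcal T_\rho(\mathbf r,\mathbf c))\in(0,\infty)$, $\lambda_{\mathbf r,\mathbf c,\rho}$ is the probability measure obtained by normalizing the restriction of $\mu^{\otimes(m\times n)}$ to $\mathcal T_\rho(\mathbf r,\mathbf c)$. An MLE for $(\mathbf r,\mathbf c)$ is a maximizer of $g^{\mathbf r,\mathbf c}(\boldsymbol\alpha,\boldsymbol\beta)=\langle\mathbf r,\boldsymbol\alpha\rangle+\langle\mathbf c,\boldsymbol\beta\rangle-\sum_{i,j}\psi(\boldsymbol\alpha(i)+\boldsymbol\beta(j))$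 over $(\boldsymbol\alpha,\boldsymbol\beta)\in\mathbb R^m\times\mathbb R^n$ with all $\boldsymbol\alpha(i)+\boldsymbol\beta(j)\in\Theta^\circ$. $Y\sim\mu_{\boldsymbol\alpha\oplus\boldsymbol\beta}$ means $Y$ is an $m\times n$ random matrix with independent entries $Y_{ij}\sim\mu_{\boldsymbol\alpha(i)+\boldsymbol\beta(j)}$. For $\delta>0$ let $A_\delta=\max(A+\delta,-1/\delta)$, $B_\delta=\min(B-\delta,1/\delta)$. The margin $(\mathbf r,\mathbf c)$ is $\delta$-tame if an MLE $(\boldsymbol\alpha,\boldsymbol\beta)$ exists and $A_\delta\le\psi'(\boldsymbol\alpha(i)+\boldsymbol\beta(j))\le B_\delta$ for all $i,j$. *)

(* Defs.v *)
From HB Require Import structures.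
From mathcomp Require Import all_boot all_order all_algebra.
From mathcomp Require Import all_classical all_reals all_analysis.

Set Implicit Arguments.
Unset Strict Implicit.
Unset Printing Implicit Defensive.

Import Order.TTheory GRing.Theory Num.Theory.
Import numFieldNormedType.Exports.

Local Open Scope classical_set_scope.
Local Open Scope ring_scope.

Section base_measure.
Context (R : realType).
Variable mu : set (measurableTypeR R) -> \bar R.

Definition msupp : set R :=
  [set x | forall U : set R, open U -> U x -> (0 < mu U)%E].

Definition inf_supp : \bar R := ereal_inf (EFin @` msupp).
Definition sup_supp : \bar R := ereal_sup (EFin @` msupp).

Definition laplace (theta : R) : \bar R := (\int[mu]_x (expR (theta * x))%:E)%E.

Definition Theta : set R := [set theta | (laplace theta < +oo)%E].

(* Only meaningful on Theta when mu is nonzero: [fine +oo] and [ln 0] are 0. *)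
Definition psi (theta : R) : R := ln (fine (laplace theta)).

Definition tilted (theta : R) (E : set (measurableTypeR R)) : \bar R :=
  (\int[mu]_(x in E) (expR (theta * x - psi theta))%:E)%E.

(* [%classic] selects the analytic derivative rather than that of polynomials. *)
Definition regular_base : Prop :=
  [/\ Theta !=set0, forall theta, Theta <> [set theta],
      forall theta, Theta° theta -> 0 < psi^`(2)%classic theta &
      set_bij Theta° [set x | (inf_supp < x%:E < sup_supp)%E] psi^`()%classic].

End base_measure.

Section matrix_product.
Context (R : realType).

Definition borelmx (m n : nat) := g_sigma_algebraType (@open 'M[R]_(m, n)).

(* [\x] and [pushforward] act on bare set functions, so the iterated product
   needs no bundled measure; it is a measure as soon as mu is sigma-finite. *)
Fixpoint tuple_prod (mu : set (measurableTypeR R) -> \bar R) (k : nat) :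
    set (k.-tuple (measurableTypeR R)) -> \bar R :=
  match k with
  | 0 => dirac [tuple]
  | k'.+1 => pushforward (mu \x @tuple_prod mu k')%E
               (fun p => [tuple of p.1 :: p.2])
  end.

Definition mx_of_tuple (m n : nat) (t : (m * n)%N.-tuple (measurableTypeR R)) :
    borelmx m n :=
  \matrix_(i < m, j < n) tnth t (mxvec_index i j).

Definition mx_prod (mu : set (measurableTypeR R) -> \bar R) (m n : nat) :
    set (borelmx m n) -> \bar R :=
  pushforward (@tuple_prod mu (m * n)%N) (@mx_of_tuple m n).

End matrix_product.

Section margins.
Context (R : realType) (m n : nat).
Implicit Types (x : 'M[R]_(m, n)) (r : 'rV[R]_m) (c : 'rV[R]_n).

Definition l1norm (k : nat) (v : 'rV[R]_k) : R := \sum_(i < k) `|v 0 i|.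

Definition row_sums x : 'rV[R]_m := \row_i \sum_j x i j.
Definition col_sums x : 'rV[R]_n := \row_j \sum_i x i j.

Definition transport (rho : R) r c : set 'M[R]_(m, n) :=
  [set x | l1norm (row_sums x - r) <= rho /\ l1norm (col_sums x - c) <= rho].

Variable mu : set (measurableTypeR R) -> \bar R.

Definition lambda (rho : R) r c (E : set (borelmx R m n)) : \bar R :=
  (mx_prod mu (E `&` transport rho r c) / mx_prod mu (transport rho r c))%E.

Definition potentials (alpha : 'rV[R]_m) (beta : 'rV[R]_n) : Prop :=
  forall i j, (Theta mu)° (alpha 0 i + beta 0 j).

Definition dual_obj r c (alpha : 'rV[R]_m) (beta : 'rV[R]_n) : R :=
  \sum_i r 0 i * alpha 0 i + \sum_j c 0 j * beta 0 j
  - \sum_i \sum_j psi mu (alpha 0 i + beta 0 j).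

Definition is_MLE r c (alpha : 'rV[R]_m) (beta : 'rV[R]_n) : Prop :=
  potentials alpha beta /\
  forall alpha' beta', potentials alpha' beta' ->
    dual_obj r c alpha' beta' <= dual_obj r c alpha beta.

Definition lower_tame (delta : R) : \bar R :=
  Order.max (inf_supp mu + delta%:E)%E (- delta^-1)%:E.
Definition upper_tame (delta : R) : \bar R :=
  Order.min (sup_supp mu - delta%:E)%E (delta^-1)%:E.

Definition tame (delta : R) r c : Prop :=
  exists alpha beta, is_MLE r c alpha beta /\
    forall i j, (lower_tame delta <= ((psi mu)^`()%classic (alpha 0 i + beta 0 j))%:E
                                  <= upper_tame delta)%E.

End margins.

Section random_matrices.
Context (R : realType) (m n : nat).
Context (d : measure_display) (Omega : measurableType d).
Variables (P : probability Omega R) (X : {RV P >-> borelmx R m n}).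

Definition entry (i : 'I_m) (j : 'I_n) (w : Omega) : measurableTypeR R :=
  (X w : 'M[R]_(m, n)) i j.

Definition indep_entries : Prop :=
  forall (J : {set 'I_m * 'I_n})
         (A : 'I_m -> 'I_n -> set (measurableTypeR R)),
    (forall i j, measurable (A i j)) ->
    P (\bigcap_(ij in [set` J]) (entry ij.1 ij.2 @^-1` A ij.1 ij.2)) =
    (\prod_(ij in J) P (entry ij.1 ij.2 @^-1` A ij.1 ij.2))%E.

(* $X\sim\mu_{\alpha\oplus\beta}$ *)
Definition tilted_matrix (mu : set (measurableTypeR R) -> \bar R)
    (alpha : 'rV[R]_m) (beta : 'rV[R]_n) : Prop :=
  indep_entries /\
  forall i j (A : set (measurableTypeR R)), measurable A ->
    P (entry i j @^-1` A) = tilted mu (alpha 0 i + beta 0 j) A.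

Definition has_law (nu : set (borelmx R m n) -> \bar R) : Prop :=
  forall E : set (borelmx R m n), measurable E -> distribution P X E = nu E.

End random_matrices.

(* Main.v *)
Require Import Defs.
From HB Require Import structures.
From mathcomp Require Import all_boot all_order all_algebra.
From mathcomp Require Import all_classical all_reals all_analysis.
From mathcomp Require Import measurable_realfun.
From mathcomp Require Import ring lra.

(* On the transportation set the density of [Y] with respect to the product of
   [mu] is [exp (dual objective + <r(x) - r, alpha> + <c(x) - c, beta>)], hence
   constant up to a factor [exp (O(rho))]: by uniqueness of [alpha (+) beta] and
   monotonicity of [psi'], tameness confines each [alpha i + beta j] to a compact
   part of the interior of [Theta] depending only on [mu] and [delta], and a
   gauge shift then bounds [alpha] and [beta].  This gives the first inequality.
   For the second one, the stationarity equations of the MLE say that [r] and [c]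
   are the expected margins of [Y], the entries of [Y] are uniformly
   sub-Gaussian near the origin of the exponential parameter, and a Chernoff
   bound summed over sign patterns gives [P (Y in T_rho) >= 1/2]. *)

Set Implicit Arguments.
Unset Strict Implicit.
Unset Printing Implicit Defensive.

Import Order.TTheory GRing.Theory Num.Theory.
Import numFieldNormedType.Exports.

Local Open Scope classical_set_scope.
Local Open Scope ring_scope.

(** * Finite powers of a sigma-finite measure *)

(** [mx_prod] is a bare set function and [tilted_matrix] only prescribes probabilities of boxes, so
    laws are pulled back to tuples, where bundled measures, Tonelli and uniqueness on boxes are
    available. No bound on the dual objective is established: it cancels because the density is used
    both from below and from above, which is also why the gauge constant enters [C1] twice. A single
    quadratic remainder estimate for the Laplace transform serves two purposes: it gives the
    derivative of [psi], and the sub-Gaussian bound once the transform is bounded below on the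
    compact interval. The Chernoff parameter is [s / sqrt n] for rows and [s / sqrt m] for columns.
    The sign patterns and the [m * n] moment factors then cost an exponent linear in the number of
    rows, respectively columns, and this fixes the scale [sqrt (m * n * (m + n))] of [rho]. *)

Lemma sigma_finite_product d1 d2 (T1 : measurableType d1)
    (T2 : measurableType d2) (R : realType)
    (m1 : {sigma_finite_measure set T1 -> \bar R})
    (m2 : {sigma_finite_measure set T2 -> \bar R}) :
  sigma_finite setT (m1 \x m2)%E.
Proof.
have /sigma_finiteP[F [TF ndF Foo]] := sigma_finiteT m1.
have /sigma_finiteP[G [TG ndG Goo]] := sigma_finiteT m2.
(* Both exhaustions are nondecreasing, so a pair lies in the box whose index is the maximum of the
   two indices. *)
exists (fun n => F n `*` G n).
  rewrite -setXTT TF TG predeqE => -[x y]; split => [[/= [i _ Fx] [j _ Gy]]|].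
    exists (maxn i j) => //; split.
    - by move: x Fx; exact/subsetPset/ndF/leq_maxl.
    - by move: y Gy; exact/subsetPset/ndG/leq_maxr.
  by move=> [n _ []/= ? ?]; split; exists n.
move=> k; have [? ?] := Foo k; have [? ?] := Goo k.
split; first exact: measurableX.
by rewrite product_measure1E// lte_mul_pinfty// ge0_fin_numE.
Qed.

Section sigma_finite_pack.
Context d (T : measurableType d) (R : realType).
Variable P : {measure set T -> \bar R}.
Hypothesis sP : sigma_finite setT P.

Let nu : set T -> \bar R := P.
HB.instance Definition _ := Measure.copy nu P.
HB.instance Definition _ := Measure_isSigmaFinite.Build d T R nu sP.

(** Attaches a proof of sigma-finiteness to a measure, so that the next product in the induction can
    take it as a factor. *)
Definition sigma_finite_pack : {sigma_finite_measure set T -> \bar R} := nu.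

End sigma_finite_pack.

Section tuple_cons.
Context d (T : measurableType d) (R : realType).

Definition tuple_cons (k : nat) (p : T * k.-tuple T) : k.+1.-tuple T :=
  [tuple of p.1 :: p.2].

Lemma measurable_tuple_cons k : measurable_fun setT (@tuple_cons k).
Proof. exact: measurable_cons. Qed.

(** [tuple_cons] has the measurable left inverse [g], so preimages under [g] of an exhaustion of the
    pair space keep their finite mass. *)
Lemma sigma_finite_tuple_cons k
    (nu : {measure set (T * k.-tuple T)%type -> \bar R}) :
  sigma_finite setT nu -> sigma_finite setT (pushforward nu (@tuple_cons k)).
Proof.
move=> [F TF Foo].
pose g (t : k.+1.-tuple T) : T * k.-tuple T :=
  (tnth t ord0, [tuple of behead t]).
have gK p : g (tuple_cons p) = p.
  by case: p => x t; rewrite /g /tuple_cons; congr (_, _); exact: val_inj.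
have mg : measurable_fun setT g.
  by apply: measurable_fun_pair; [exact: measurable_tnth|
     exact: measurable_behead].
exists (fun n => g @^-1` F n).
  by rewrite -preimage_bigcup -TF preimage_setT.
move=> n; have [mF Foo_] := Foo n; split.
  by rewrite -[_ @^-1` _]setTI; exact: mg.
rewrite /pushforward -comp_preimage (_ : g \o _ = id)//.
by apply/funext => p /=; exact: gK.
Qed.

Variables (mu : {sigma_finite_measure set T -> \bar R}) (k : nat).
Variable N : {sigma_finite_measure set (k.-tuple T) -> \bar R}.

Lemma tuple_cons_measure :
  exists M : {sigma_finite_measure set (k.+1.-tuple T) -> \bar R},
    (M : set _ -> \bar R) = pushforward (mu \x N)%E (@tuple_cons k).
Proof.
have s := sigma_finite_tuple_cons (sigma_finite_product mu N).
by unshelve eexists (sigma_finite_pack s); first exact: measurable_tuple_cons.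
Qed.

Lemma integral_tuple_cons (f : k.+1.-tuple T -> R) :
  measurable_fun setT f -> (forall t, 0 <= f t) ->
  (\int[pushforward (mu \x N) (@tuple_cons k)]_t (f t)%:E =
   \int[mu]_x \int[N]_t (f (tuple_cons (x, t)))%:E)%E.
Proof.
move=> mf f0.
rewrite (@ge0_integral_pushforward _ _ _ _ _ _ (@measurable_tuple_cons k)
  (mu \x N)%E setT)//.
- rewrite preimage_setT fubini_tonelli1//=.
  + exact: sigma_finiteT.
  + apply/measurable_EFinP; apply: (measurableT_comp mf).
    exact: measurable_tuple_cons.
  + by move=> p; rewrite lee_fin.
- by apply/measurable_EFinP.
- by move=> t _; rewrite lee_fin.
Qed.

End tuple_cons.

Section tuple_measure.
Context (R : realType).
Variable mu : {sigma_finite_measure set (measurableTypeR R) -> \bar R}.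

(** Bridge from the bare set function to the integration theory. Later statements carry such an [M]
    together with its equation, here proved to exist. *)
Lemma tuple_prod_measure (k : nat) :
  exists M : {sigma_finite_measure set (k.-tuple (measurableTypeR R)) -> \bar R},
    (M : set _ -> \bar R) = tuple_prod mu (k := k).
Proof.
elim: k => [|k [M EM]].
  by exists (dirac ([tuple] : 0.-tuple (measurableTypeR R))).
have [N EN] := tuple_cons_measure mu M.
by exists N; rewrite EN EM.
Qed.

(** Tonelli, one coordinate at a time; nonnegativity makes integrability irrelevant. *)
Lemma integral_tuple_prod (k : nat)
    (M : {sigma_finite_measure set (k.-tuple (measurableTypeR R)) -> \bar R})
    (g : 'I_k -> measurableTypeR R -> R) :
  (M : set _ -> \bar R) = tuple_prod mu (k := k) ->
  (forall i, measurable_fun setT (g i)) -> (forall i x, 0 <= g i x) ->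
  (\int[M]_t (\prod_(i < k) g i (tnth t i))%:E =
   \prod_(i < k) \int[mu]_x (g i x)%:E)%E.
Proof.
elim: k M g => [|k IH] M g EM mg g0.
  under eq_integral do rewrite big_ord0.
  rewrite big_ord0 EM /= integral_cst//.
  by rewrite mul1e; exact: diracT.
have [N EN] := tuple_prod_measure k.
have mP (h : 'I_k -> measurableTypeR R -> R) :
    (forall i, measurable_fun setT (h i)) ->
  measurable_fun setT
    (fun t : k.-tuple (measurableTypeR R) => \prod_(i < k) h i (tnth t i)).
  move=> mh; apply: measurable_prod => i _.
  by apply: measurableT_comp => //; exact: measurable_tnth.
have mP1 : measurable_fun setT
    (fun t : k.+1.-tuple (measurableTypeR R) => \prod_(i < k.+1) g i (tnth t i)).
  apply: measurable_prod => i _.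
  by apply: measurableT_comp => //; exact: measurable_tnth.
rewrite EM /= -EN (@integral_tuple_cons _ (measurableTypeR R))//; last first.
  by move=> t; rewrite prodr_ge0.
rewrite big_ord_recl /= muleC.
under eq_integral => x _.
  under eq_integral => t _.
    rewrite big_ord_recl /= {1}/tuple_cons /= tnth0.
    under eq_bigr do rewrite /tuple_cons tnthS /=.
    rewrite EFinM; over.
  rewrite ge0_integralZl//; first last.
  - by rewrite lee_fin.
  - by move=> t _; rewrite lee_fin prodr_ge0.
  - apply/measurable_EFinP.
    exact: (mP (fun i => g (lift ord0 i))).
  rewrite (IH N (fun i => g (lift ord0 i)))//.
  rewrite muleC; over.
rewrite /= ge0_integralZl//; first last.
- by apply: prode_ge0 => i _; apply: integral_ge0 => x _; rewrite lee_fin.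
- by move=> x _; rewrite lee_fin.
- exact/measurable_EFinP.
Qed.

End tuple_measure.

(** * Uniqueness of finite measures on tuples *)

Section tuple_box.
Context d (T : measurableType d) (R : realType) (k : nat).

Definition tuple_box (A : 'I_k -> set T) : set (k.-tuple T) :=
  [set t | forall i, A i (tnth t i)].

Lemma measurable_tuple_box A :
  (forall i, measurable (A i)) -> measurable (tuple_box A).
Proof.
move=> mA; rewrite [X in measurable X](_ : _ =
  \bigcap_(i in [set: 'I_k]) ((@tnth k T ^~ i) @^-1` A i)).
  apply: fin_bigcap_measurable => // i _.
  by rewrite -[_ @^-1` _]setTI; exact: measurable_tnth.
by apply/seteqP; split => t /= h i; [move=> _; exact: h|exact: (h i)].
Qed.

(** Boxes are stable under intersection and generate the sigma-algebra of tuples; since [m1] is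
    finite, the constant sequence [setT] is an admissible cover. *)
Lemma tuple_measure_unique (m1 m2 : {measure set (k.-tuple T) -> \bar R}) :
  (m1 setT < +oo)%E ->
  (forall A : 'I_k -> set T, (forall i, measurable (A i)) ->
    m1 (tuple_box A) = m2 (tuple_box A)) ->
  forall E, measurable E -> m1 E = m2 E.
Proof.
move=> m1oo m12; pose G : set (set (k.-tuple T)) :=
  [set B | exists2 A, (forall i, measurable (A i)) & B = tuple_box A].
have GT : G setT.
  by exists (fun=> setT); [|apply/seteqP; split].
apply: (measure_unique G (fun=> setT)) => //.
- apply/seteqP; split; last first.
    apply: smallest_sub; first exact: sigma_algebra_measurable.
    by move=> _ [A mA ->]; exact: measurable_tuple_box.
  apply: smallest_sub; first exact: smallest_sigma_algebra.
  move=> B; rewrite -bigcup_seq/= => -[i /= _ [A mA <-]].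
  apply: sub_sigma_algebra.
  (* A generator of the product sigma-algebra constrains one coordinate only: it is a box with full
     sides elsewhere. *)
  exists (fun j => if j == i then A else setT).
    by move=> j; case: ifP.
  apply/seteqP; split => [t /= [_ ti] j|t /= /(_ i)]; last by rewrite eqxx.
  by case: eqP => [->|].
- move=> _ _ [A mA ->] [B mB ->]; exists (fun i => A i `&` B i).
    by move=> i; exact: measurableI.
  apply/seteqP; split => [t /= [tA tB] i|t /= tAB]; first by split.
  by split => i; have [] := tAB i.
- by rewrite bigcup_const.
- by move=> _ [A mA ->]; exact: m12.
Qed.

End tuple_box.

Section density.
Context d (T : measurableType d) (R : realType) (mu : {measure set T -> \bar R}).
Variables (f : T -> R) (mf : measurable_fun setT f) (f0 : forall x, 0 <= f x).

Let nu E : \bar R := (\int[mu]_(x in E) (f x)%:E)%E.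

Let nu_set0 : nu set0 = 0%E. Proof. exact: integral_set0. Qed.

Let nu_ge0 E : (0 <= nu E)%E.
Proof. by apply: integral_ge0 => x _; rewrite lee_fin. Qed.

Let nu_sigma_additive : semi_sigma_additive nu.
Proof.
move=> F mF tF mUF; rewrite [X in _ --> X]/nu ge0_integral_bigcup//.
- by apply: is_cvg_nneseries => // i _ _; exact: nu_ge0.
- by apply/measurable_EFinP; exact: measurable_funTS.
- by move=> x _; rewrite lee_fin.
Qed.

HB.instance Definition _ := isMeasure.Build d T R nu
  nu_set0 nu_ge0 nu_sigma_additive.

(** Bundled because the uniqueness lemma compares measures, not integrals. *)
Definition density : {measure set T -> \bar R} := nu.

End density.

(** * Measurability for the Borel sigma-algebra of matrices *)

Section borel_matrices.
Context (R : realType) (m n : nat).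

Lemma measurable_mx_entry (i : 'I_m) (j : 'I_n) :
  measurable_fun setT
    ((fun x : 'M[R]_(m, n) => x i j) : borelmx R m n -> measurableTypeR R).
Proof.
apply: (measurability _ (RGenOInfty.measurableE R)).
move=> _ [_ [a ->] <-]; rewrite setTI; apply: sub_sigma_algebra => /=.
apply: (@open_comp _ _ (fun x : 'M[R]_(m, n) => x i j)).
  by move=> x _; exact: coord_continuous.
rewrite set_itvE; exact: open_gt.
Qed.

(** Borel sets of matrices are generated by open sets, those of tuples by coordinates. Second
    countability reconciles the two: an open set is a countable union of cubes with rational
    centres, and each cube pulls back to a box. *)
Lemma measurable_mx_of_tuple : measurable_fun setT (@mx_of_tuple R m n).
Proof.
apply: (@measurability _ _ _ (borelmx R m n) setT _ (@open 'M[R]_(m, n))) => //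
  _ [U oU <-].
pose B (p : 'M[rat]_(m, n) * nat) : set 'M[R]_(m, n) :=
  [set y | forall i j, `|ratr (p.1 i j) - y i j| < p.2.+1%:R^-1].
(* Cubes not contained in [U] are replaced by the empty set, so that the union runs over a countable
   type. *)
have UE : U = \bigcup_p (if asbool (B p `<=` U) then B p else set0).
  apply/seteqP; split => [x Ux|x [p _]]; last first.
    by case: asboolP => // pU; exact: pU.
  move: oU; rewrite openE => /(_ _ Ux); rewrite /interior.
  move=> /nbhs_ballP [e /= e0 eU].
  (* Twice the radius [1 / (k + 1)] is below [e]: a point of the cube is reached from [x] through
     the rational centre. *)
  pose k := Num.truncn (2 / e).
  have k0 : (0 : R) < k.+1%:R^-1 by rewrite invr_gt0.
  have ke : k.+1%:R^-1 *+ 2 < e.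
    have : 2 / e < k.+1%:R by exact: truncnS_gt.
    by rewrite -(mulr_natl _^-1 2) ltr_pdivrMr// ltr_pdivrMr// mulrC.
  have /choice[q qP] : forall ij : 'I_m * 'I_n,
      exists q : rat, `|ratr q - x ij.1 ij.2| < k.+1%:R^-1.
    move=> [i j]/=.
    have /rat_in_itvoo[q] : x i j < x i j + k.+1%:R^-1 by rewrite ltrDl.
    rewrite in_itv/= => /andP[xq qx]; exists q.
    by rewrite ger0_norm ?subr_ge0 ?ltW// ltrBlDl.
  exists (\matrix_(i, j) q (i, j), k) => //.
  case: asboolP => [_ i j|[]]; first by rewrite mxE; exact: (qP (i, j)).
  move=> y By; apply: eU; split => // i j; rewrite /ball/=.
  apply: le_lt_trans ke; rewrite mulr2n.
  have /= := By i j; rewrite mxE => /ltW h; have /= /ltW := qP (i, j).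
  rewrite distrC => h'; apply: le_trans (lerD h' h).
  by rewrite -[x i j - y i j](subrKA (ratr (q (i, j)))) ler_normD.
rewrite setTI UE preimage_bigcup; apply: countable_bigcupT_measurable => // p.
case: asboolP => _; last by rewrite preimage_set0.
rewrite [X in measurable X](_ : _ = tuple_box (fun a =>
    [set y : R | `|ratr (mxvec p.1 0 a) - y| < p.2.+1%:R^-1] :
    set (measurableTypeR R))).
  apply: measurable_tuple_box => a.
  rewrite -[X in measurable X]setTI.
  apply: (@measurable_fun_ltr _ _ _ setT
    (fun y : R => `|ratr (mxvec p.1 0 a) - y|) (fun=> p.2.+1%:R^-1) _ _
    measurableT [set true]) => //.
  by apply: measurableT_comp => //; exact: measurable_funB.
apply/seteqP; split => t /= h; last first.
  by move=> i j; rewrite mxE; have := h (mxvec_index i j); rewrite mxvecE.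
move=> a; case/mxvec_indexP: a => i j.
by have := h i j; rewrite mxE mxvecE.
Qed.

Lemma measurable_l1norm_le (p : nat) (f : borelmx R m n -> 'rV[R]_p) (rho : R) :
  (forall i, measurable_fun setT (fun x => f x 0 i)) ->
  measurable [set x | l1norm (f x) <= rho].
Proof.
move=> mf.
have ml : measurable_fun setT (fun x => l1norm (f x)).
  by apply: measurable_sum => i; exact: measurableT_comp.
have mrho : measurable_fun setT ((fun=> rho) : borelmx R m n -> R) by [].
have := measurable_fun_ler ml mrho measurableT (Y := [set true]).
by rewrite setTI; apply.
Qed.

Lemma measurable_row_transport (rho : R) (r : 'rV[R]_m) :
  measurable ([set x | l1norm (row_sums x - r) <= rho] : set (borelmx R m n)).
Proof.
apply: (@measurable_l1norm_le _ (fun x => row_sums x - r)) => i.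
under eq_fun do rewrite !mxE.
apply: measurable_funB => //; apply: measurable_sum => j.
exact: measurable_mx_entry.
Qed.

Lemma measurable_col_transport (rho : R) (c : 'rV[R]_n) :
  measurable ([set x | l1norm (col_sums x - c) <= rho] : set (borelmx R m n)).
Proof.
apply: (@measurable_l1norm_le _ (fun x => col_sums x - c)) => j.
under eq_fun do rewrite !mxE.
apply: measurable_funB => //; apply: measurable_sum => i.
exact: measurable_mx_entry.
Qed.

Lemma measurable_transport (rho : R) (r : 'rV[R]_m) (c : 'rV[R]_n) :
  measurable (transport rho r c : set (borelmx R m n)).
Proof.
exact: measurableI (measurable_row_transport _ _) (measurable_col_transport _ _).
Qed.

End borel_matrices.

(** * The law of the tilted matrix as a density on tuples *)

Section tilted_matrix_law.
Context (R : realType).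
Variable mu : {sigma_finite_measure set (measurableTypeR R) -> \bar R}.

Definition tilted_density (k : nat) (th : 'rV[R]_k)
    (t : k.-tuple (measurableTypeR R)) : R :=
  \prod_(a < k) expR (th 0 a * tnth t a - psi mu (th 0 a)).

Lemma measurable_tilted_density k th :
  measurable_fun setT (@tilted_density k th).
Proof.
apply: measurable_prod => a _; apply: measurableT_comp => //.
apply: measurable_funB => //; apply: measurable_funM => //.
exact: measurable_tnth.
Qed.

Lemma tilted_density_gt0 k th t : 0 < @tilted_density k th t.
Proof. by apply: prodr_gt0 => a _; exact: expR_gt0. Qed.

(** The indicator of the box is distributed over the factors [g a], which leaves a pure product to
    integrate. *)
Lemma tilted_density_box k (th : 'rV[R]_k)
    (M : {sigma_finite_measure set (k.-tuple (measurableTypeR R)) -> \bar R})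
    (A : 'I_k -> set (measurableTypeR R)) :
  (M : set _ -> \bar R) = tuple_prod mu (k := k) ->
  (forall a, measurable (A a)) ->
  (\int[M]_(t in tuple_box A) (tilted_density th t)%:E =
   \prod_(a < k) tilted mu (th 0%R a) (A a))%E.
Proof.
move=> EM mA; rewrite integral_mkcond.
pose g a (x : measurableTypeR R) :=
  expR (th 0 a * x - psi mu (th 0 a)) * \1_(A a) x.
transitivity (\int[M]_t (\prod_(a < k) g a (tnth t a))%:E)%E.
  apply: eq_integral => t _; rewrite patchE; case: ifPn => [|]; rewrite ?inE => tA.
    congr EFin; apply: eq_bigr => a _.
    by rewrite /g indicE mem_set ?mulr1//; exact: tA.
  have [a Aa] : exists a, ~ A a (tnth t a).
    apply: contrapT => /forallNP h; move: tA; rewrite notin_setE; apply => a.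
    by apply: contrapT; exact: h.
  have g0 : g a (tnth t a) = 0 by rewrite /g indicE memNset// mulr0.
  congr EFin; apply/esym/eqP/prodf_eq0; exists a; first by [].
  by apply/eqP.
have mf a : measurable_fun setT
    (fun x : measurableTypeR R => expR (th 0 a * x - psi mu (th 0 a))).
  apply: measurableT_comp => //.
  by apply: measurable_funB => //; exact: measurable_funM.
rewrite (integral_tuple_prod EM)//.
- apply: eq_bigr => a _; rewrite /tilted [in RHS]integral_mkcond.
  apply: eq_integral => x _; rewrite patchE /g indicE.
  by case: ifPn => _; rewrite ?mulr1 ?mulr0.
- by move=> a; apply: measurable_funM => //; exact: measurable_indic.
- by move=> a x; rewrite mulr_ge0 ?expR_ge0.
Qed.

Context (m n : nat) (d : measure_display) (Omega : measurableType d).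
Variables (P : probability Omega R) (Y : {RV P >-> borelmx R m n}).
Variables (alpha : 'rV[R]_m) (beta : 'rV[R]_n).

(** The direct sum of [alpha] and [beta], flattened in the coordinate order of [mx_of_tuple]. *)
Definition potential_row : 'rV[R]_(m * n) :=
  mxvec (\matrix_(i, j) (alpha 0 i + beta 0 j)).

Lemma potential_rowE i j :
  potential_row 0 (mxvec_index i j) = alpha 0 i + beta 0 j.
Proof. by rewrite mxvecE mxE. Qed.

Lemma big_mxvec_index (T : Type) (idx : T) (op : Monoid.com_law idx)
    (F : 'I_(m * n) -> T) :
  \big[op/idx]_(a < m * n) F a =
  \big[op/idx]_i \big[op/idx]_j F (mxvec_index i j).
Proof.
rewrite pair_bigA (reindex _ (curry_mxvec_bij _ _))/=.
by apply: eq_bigr => -[].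
Qed.

(** Independence and the marginals determine the law on boxes only; uniqueness on tuples, applied to
    the flattened matrix [Z], extends the formula to every Borel set. *)
Lemma tilted_matrix_law
  (M : {sigma_finite_measure set ((m * n).-tuple (measurableTypeR R)) -> \bar R}) :
  (M : set _ -> \bar R) = tuple_prod mu (k := (m * n)%N) ->
  tilted_matrix Y mu alpha beta ->
  forall E : set (borelmx R m n), measurable E ->
  P (Y @^-1` E) = (\int[M]_(t in @mx_of_tuple R m n @^-1` E)
    (tilted_density potential_row t)%:E)%E.
Proof.
move=> EM [indepY lawY] E mE.
pose Z w : (m * n).-tuple (measurableTypeR R) :=
  [tuple (mxvec (Y w : 'M[R]_(m, n)) 0 a) | a < (m * n)%N].
have mZ : measurable_fun setT Z.
  apply/measurable_fun_tnthP => a; case/mxvec_indexP: a => i j.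
  rewrite (_ : _ \o _ = (fun x : borelmx R m n => (x : 'M[R]_(m, n)) i j) \o Y).
    by apply: measurableT_comp => //; exact: measurable_mx_entry.
  by apply/funext => w /=; rewrite tnth_mktuple mxvecE.
have ZK w : mx_of_tuple (Z w) = Y w :> 'M[R]_(m, n).
  by apply/matrixP => i j; rewrite mxE tnth_mktuple mxvecE.
transitivity (pushforward P Z (@mx_of_tuple R m n @^-1` E)).
  rewrite /pushforward; congr (P _).
  by apply/funext => w; rewrite /preimage /= ZK.
have F0 t : 0 <= tilted_density potential_row t.
  exact/ltW/tilted_density_gt0.
have mF := measurable_tilted_density potential_row.
apply: (@tuple_measure_unique _ (measurableTypeR R) R _ _
  (density M mF F0)); last first.
- by rewrite -[X in measurable X]setTI; exact: measurable_mx_of_tuple.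
- move=> A mA; rewrite /density /= tilted_density_box//.
  rewrite /pushforward big_mxvec_index pair_bigA /=.
  have := indepY (finset.setTfor ('I_m * 'I_n)%type)
    (fun i j => A (mxvec_index i j)) (fun i j => mA _).
  rewrite (_ : \bigcap_(ij in _) _ = Z @^-1` tuple_box A); last first.
    apply/seteqP; split => w /= h.
      move=> a; case/mxvec_indexP: a => i j; rewrite tnth_mktuple mxvecE.
      by apply: (h (i, j)); rewrite /= finset.in_setT.
    move=> [i j] _ /=; have := h (mxvec_index i j).
    by rewrite tnth_mktuple mxvecE.
  move=> ->; apply: eq_big => [ij|[i j] _]; first by rewrite finset.in_setT.
  rewrite -[RHS]/(tilted mu (potential_row 0 (mxvec_index i j))
    (A (mxvec_index i j))) potential_rowE.
  exact: (lawY i j _ (mA (mxvec_index i j))).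
- have : (P setT < +oo)%E by rewrite probability_setT ltry.
  exact.
Qed.

End tilted_matrix_law.

(** * Laplace transform and cumulant function *)

Section expR_inequalities.
Context (R : realType).
Implicit Types x y u h s : R.

Lemma expR_norm_le u : expR `|u| <= expR u + expR (- u).
Proof. by case: (ger0P u) => _; rewrite ?lerDl ?lerDr expR_ge0. Qed.

Lemma norm_le_expR u : `|u| <= expR u + expR (- u).
Proof.
apply: le_trans (expR_norm_le u); apply: le_trans (expR_ge1Dx _).
by rewrite lerDr.
Qed.

Lemma expR_sub_taylor1_ge0 y : 0 <= expR y - 1 - y.
Proof. by have := expR_ge1Dx y; lra. Qed.

(** For either sign, [expR y * (1 - y) <= 1] gives [expR y - 1 - y <= y * (expR y - 1)]; a second
    factor [y] comes from comparing [expR y - 1] with [y * expR y] or with [y]. *)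
Lemma expR_sub_taylor1_le y : expR y - 1 - y <= y ^+ 2 * expR `|y|.
Proof.
have e1 : expR y * (1 - y) <= 1.
  have := expR_ge1Dx (- y); rewrite -(ler_pM2l (expR_gt0 y)) => /le_trans; apply.
  by rewrite expRxMexpNx_1.
have e2 := expR_ge1Dx y; have e3 := expR_gt0 y.
case: (ger0P y) => y0; first by nra.
have e4 : 1 <= expR (- y) by rewrite -expR0 ler_expR; lra.
by nra.
Qed.

(** With [u = s * x], the remainder is at most [(h / s) ^+ 2 * u ^+ 2 * expR |u|], and
    [u ^+ 2 <= 2 * expR |u|] trades the polynomial factor for a doubled exponent. The result is a
    sum of two exponentials, integrable after tilting. *)
Lemma expR_taylor1 x h s : 0 < s -> `|h| <= s ->
  `|expR (h * x) - 1 - h * x| <=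
  2 * (h / s) ^+ 2 * (expR (2 * s * x) + expR (- (2 * s * x))).
Proof.
move=> s0 hs; rewrite ger0_norm ?expR_sub_taylor1_ge0//.
apply: le_trans (expR_sub_taylor1_le _) _.
pose u := s * x.
have -> : h * x = (h / s) * u by rewrite /u mulrA divfK ?gt_eqF.
have hu : `|h / s * u| <= `|u|.
  by rewrite normrM ler_piMl// normf_div (gtr0_norm s0) ler_pdivrMr// mul1r.
rewrite exprMn (mulrC 2 (_ ^+ 2)) -2!(mulrA (_ ^+ 2)).
rewrite ler_wpM2l ?sqr_ge0// -(mulrA 2 s x) -/u.
have u2 : u ^+ 2 <= 2 * expR `|u|.
  have h1 : 1 + u ^+ 2 / 2 <= expR `|u|.
    have := expR_ge1Dxn 1 (normr_ge0 u).
    by rewrite real_normK ?num_real// (_ : 2`! = 2)%N.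
  by move: h1; lra.
apply: (@le_trans _ _ (2 * expR `|u| * expR `|u|)).
  by apply: ler_pM => //; rewrite ?expR_ge0 ?sqr_ge0 ?ler_expR.
rewrite -mulrA -expRD ler_wpM2l//.
apply: le_trans (expR_norm_le _).
by rewrite ler_expR (normrM 2 u) normr_nat mulr_natl mulr2n.
Qed.

End expR_inequalities.

Section laplace_transform.
Context (R : realType) (mu : {measure set (measurableTypeR R) -> \bar R}).
Implicit Types th s h : R.

Definition mgf th : R := fine (laplace mu th).
Definition mgf1 th : R := Rintegral mu setT (fun x => x * expR (th * x)).

Lemma measurable_expRM th :
  measurable_fun setT (fun x : measurableTypeR R => expR (th * x)).
Proof. by apply: measurableT_comp => //; exact: measurable_funM. Qed.

Lemma integrable_expR th : Theta mu th ->
  mu.-integrable setT (EFin \o (fun x : measurableTypeR R => expR (th * x))).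
Proof.
move=> Tth; apply/integrableP; split.
  by apply/measurable_EFinP; exact: measurable_expRM.
by under eq_integral do rewrite /= ger0_norm ?expR_ge0//.
Qed.

Lemma expRM_between a b th x : a <= th <= b ->
  expR (th * x) <= expR (a * x) + expR (b * x) :> R.
Proof.
move=> /andP[ath thb]; case: (lerP 0 x) => x0.
  apply: (@le_trans _ _ (expR (b * x))); last by rewrite lerDr expR_ge0.
  by rewrite ler_expR ler_wpM2r.
apply: (@le_trans _ _ (expR (a * x))); last by rewrite lerDl expR_ge0.
by rewrite ler_expR ler_wnM2r// ltW.
Qed.

Lemma Theta_between a b th : Theta mu a -> Theta mu b -> a <= th <= b ->
  Theta mu th.
Proof.
move=> Ta Tb athb.
have : mu.-integrable setT
    (EFin \o (fun x : measurableTypeR R => expR (th * x))).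
  apply: le_integrable (integrableD measurableT (integrable_expR Ta)
    (integrable_expR Tb)) => //.
    by apply/measurable_EFinP; exact: measurable_expRM.
  move=> x _ /=; rewrite lee_fin !ger0_norm ?addr_ge0 ?expR_ge0//.
  exact: expRM_between.
move=> /integrableP[_]; rewrite /Theta /= /laplace.
by under eq_integral do rewrite /= ger0_norm ?expR_ge0//.
Qed.

Lemma mgf_between a b th : Theta mu a -> Theta mu b -> a <= th <= b ->
  mgf th <= mgf a + mgf b.
Proof.
move=> Ta Tb athb; have Tth := Theta_between Ta Tb athb.
rewrite /mgf /laplace -!/(Rintegral mu setT _) -RintegralD//;
  try exact: integrable_expR.
apply: le_Rintegral => //; first exact: integrable_expR.
  exact: (integrableD measurableT (integrable_expR Ta) (integrable_expR Tb)).
by move=> x _; exact: expRM_between.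
Qed.

(** Room [s] on both sides of [th] pays for the factor [x], since [|s * x|] is at most
    [expR (s * x) + expR (- (s * x))]. *)
Lemma integrable_xexpR th s : 0 < s -> Theta mu (th - s) ->
  Theta mu (th + s) ->
  mu.-integrable setT
    (EFin \o (fun x : measurableTypeR R => x * expR (th * x))).
Proof.
move=> s0 Ta Tb.
apply: le_integrable (integrableZl measurableT s^-1
  (integrableD measurableT (integrable_expR Ta) (integrable_expR Tb))) => //.
  apply/measurable_EFinP; apply: measurable_funM => //.
  exact: measurable_expRM.
move=> x _ /=; rewrite lee_fin.
rewrite normrM [X in _ <= X]ger0_norm; last first.
  by rewrite mulr_ge0 ?addr_ge0 ?expR_ge0 ?invr_ge0 ?ltW.
have -> : s^-1 * (expR ((th - s) * x) + expR ((th + s) * x)) =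
    expR (th * x) * (s^-1 * (expR (s * x) + expR (- (s * x)))).
  by rewrite mulrBl mulrDl !expRD; ring.
rewrite (ger0_norm (expR_ge0 _)) mulrC ler_pM2l ?expR_gt0//.
rewrite ler_pdivlMl// -{1}(gtr0_norm s0) -normrM.
exact: norm_le_expR.
Qed.

(** Integrates [expR_taylor1] against [expR (th * x)], in place of a differentiation under the
    integral sign. The room [2 * s] on both sides makes the bound integrable. *)
Lemma mgf_taylor1 th s h : 0 < s -> Theta mu (th - 2 * s) ->
  Theta mu (th + 2 * s) -> `|h| <= s ->
  `|mgf (th + h) - mgf th - h * mgf1 th| <=
  2 * (h / s) ^+ 2 * (mgf (th + 2 * s) + mgf (th - 2 * s)).
Proof.
move=> s0 Ta Tb hs.
have Tth t : `|t| <= 2 * s -> Theta mu (th + t).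
  by rewrite ler_norml => ts; apply: (Theta_between Ta Tb); lra.
have I t : `|t| <= 2 * s -> mu.-integrable setT
    (EFin \o (fun x : measurableTypeR R => expR ((th + t) * x))).
  by move=> ?; apply: integrable_expR; exact: Tth.
have I0 : mu.-integrable setT
    (EFin \o (fun x : measurableTypeR R => expR (th * x))).
  by rewrite -[th]addr0; apply: I; rewrite normr0; lra.
have I1 : mu.-integrable setT
    (EFin \o (fun x : measurableTypeR R => x * expR (th * x))).
  by apply: (@integrable_xexpR th (2 * s)) => //; lra.
have Ih : mu.-integrable setT
    (EFin \o (fun x : measurableTypeR R => expR ((th + h) * x))).
  by apply: I; lra.
have Ihx : mu.-integrable setT (EFin \o (fun x : measurableTypeR R =>
    h * (x * expR (th * x)))) by exact: (integrableZl measurableT h I1).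
have Ih0 : mu.-integrable setT (EFin \o (fun x : measurableTypeR R =>
    expR ((th + h) * x) - expR (th * x))).
  exact: (integrableB measurableT Ih I0).
have Ir : mu.-integrable setT (EFin \o (fun x : measurableTypeR R =>
    expR ((th + h) * x) - expR (th * x) - h * (x * expR (th * x)))).
  exact: (integrableB measurableT Ih0 Ihx).
have Ip : mu.-integrable setT (EFin \o (fun x : measurableTypeR R =>
    expR ((th + 2 * s) * x) + expR ((th - 2 * s) * x))).
  exact: (integrableD measurableT (integrable_expR Tb) (integrable_expR Ta)).
have Ipb := integrable_expR Tb.
have Ipa := integrable_expR Ta.
rewrite /mgf /laplace /mgf1 -!/(Rintegral mu setT _).
rewrite -(RintegralZl h measurableT I1) -(RintegralB measurableT Ih I0).
rewrite -(RintegralB measurableT Ih0 Ihx) -(RintegralD measurableT Ipb Ipa).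
rewrite -(RintegralZl _ measurableT Ip).
apply: (le_trans (le_normr_Rintegral measurableT Ir)).
apply: le_Rintegral => //.
- have [/measurable_EFinP mr _] := integrableP _ _ _ Ir.
  apply: le_integrable Ir => //; last by move=> x _ /=; rewrite normr_id.
  by apply/measurable_EFinP; exact: measurableT_comp.
- exact: (integrableZl measurableT _ Ip).
- move=> x _.
  have -> : expR ((th + h) * x) - expR (th * x) - h * (x * expR (th * x)) =
      expR (th * x) * (expR (h * x) - 1 - h * x).
    by rewrite mulrDl expRD; ring.
  have -> : expR ((th + 2 * s) * x) + expR ((th - 2 * s) * x) =
      expR (th * x) * (expR (2 * s * x) + expR (- (2 * s * x))).
    by rewrite mulrDl mulrBl !expRD; ring.
  rewrite normrM ger0_norm ?expR_ge0// [X in _ <= X]mulrCA.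
  rewrite ler_wpM2l ?expR_ge0//; exact: expR_taylor1.
Qed.

End laplace_transform.

Lemma is_derive_taylor1 (R : realType) (f : R -> R) (x D C s : R) : 0 < s ->
  (forall h, `|h| <= s -> `|f (x + h) - f x - h * D| <= C * h ^+ 2) ->
  is_derive x 1 f D.
Proof.
move=> s0 fC.
have C0 : 0 <= C.
  have := fC s; rewrite gtr0_norm// => /(_ (lexx _)).
  by move=> /(le_trans (normr_ge0 _)); rewrite pmulr_lge0// exprn_gt0.
suff fD : h^-1 *: ((f \o shift x) (h *: (1 : R)) - f x) @[h --> 0^'] --> D.
  apply: DeriveDef; first exact: (cvgP D).
  exact: cvg_lim.
apply/cvgrPdist_le => e e0.
(* [C] may be [0], hence the denominator [C + 1]. *)
pose t := Num.min s (e / (C + 1)).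
have t0 : 0 < t by rewrite lt_min s0 divr_gt0// ltr_wpDl.
near=> h.
have h0 : h != 0 by near: h; exact: nbhs_dnbhs_neq.
have ht : `|h| <= t.
  by near: h; apply: dnbhs0_le.
have hs : `|h| <= s by apply: le_trans ht _; rewrite ge_min lexx.
have he : `|h| * (C + 1) <= e.
  by rewrite -ler_pdivlMr ?ltr_wpDl//; apply: le_trans ht _;
    rewrite ge_min lexx orbT.
rewrite /= /shift/= [h *: 1]mulr1 distrC (addrC h x).
have -> : h^-1 *: (f (x + h) - f x) - D = h^-1 * (f (x + h) - f x - h * D).
  by rewrite [in RHS]mulrBr mulKf.
rewrite normrM normfV ler_pdivrMl ?normr_gt0//.
apply: le_trans (fC _ hs) _.
rewrite -(real_normK (num_real h)) expr2 mulrCA ler_wpM2l//.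
apply: le_trans he; rewrite mulrC ler_wpM2l//; lra.
Unshelve. all: by end_near. Qed.

(** * Derivative, monotonicity and sub-Gaussian bound *)

Section cumulant.
Context (R : realType) (mu : {measure set (measurableTypeR R) -> \bar R}).
Hypothesis hmu : regular_base mu.
Implicit Types th s t h : R.

Let T := (Theta mu)°.
Let psi' := (psi mu)^`()%classic.

Lemma psi_inj s t : T s -> T t -> psi' s = psi' t -> s = t.
Proof.
have [_ _ _ [_ inj _]] := hmu.
by move=> Ts Tt; apply: inj; rewrite inE.
Qed.

Lemma interior_Theta th : T th ->
  exists2 s, 0 < s & forall t, `|t - th| <= s -> Theta mu t.
Proof.
rewrite /T /interior => /nbhs_ballP[e /= e0 eT]; exists (e / 2).
  by rewrite divr_gt0.
move=> t te; apply: eT; rewrite /ball/= distrC; apply: le_lt_trans te _.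
by rewrite ltr_pdivrMr// ltr_pMr// ltr1n.
Qed.

Lemma interior_Theta_between a b th : Theta mu a -> Theta mu b ->
  a < th < b -> T th.
Proof.
move=> Ta Tb /andP[ath thb]; rewrite /T /interior.
apply/nbhs_ballP; exists (Num.min (th - a) (b - th)) => /=.
  by rewrite lt_min !subr_gt0 ath.
move=> t; rewrite /ball/= lt_min => /andP[].
rewrite !ltr_norml => /andP[h1 h2] /andP[h3 h4].
by apply: (Theta_between Ta Tb); lra.
Qed.

Lemma laplace_ge0 th : (0 <= laplace mu th)%E.
Proof. by apply: integral_ge0 => x _; rewrite lee_fin expR_ge0. Qed.

(** The exponential never vanishes, so a zero transform means that the whole line is null, whatever
    the parameter. *)
Lemma laplace_eq0 s t : laplace mu s = 0%E -> laplace mu t = 0%E.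
Proof.
have lap th : laplace mu th = (\int[mu]_x `|(expR (th * x))%:E|)%E.
  by apply: eq_integral => x _ /=; rewrite ger0_norm ?expR_ge0.
have mE th : measurable_fun setT
    (EFin \o (fun x : measurableTypeR R => expR (th * x))).
  by apply/measurable_EFinP; exact: measurable_expRM.
rewrite !lap => /(ae_eq_integral_abs mu measurableT (mE s)) s0.
apply/(ae_eq_integral_abs mu measurableT (mE t)).
apply: filterS s0 => x /= /(_ I) [] /eqP.
by rewrite expR_eq0.
Qed.

(** A zero transform would make [Theta] the whole line and [psi] identically [0], because [ln 0] is
    [0]; its derivative would then not be injective. *)
Lemma mgf_gt0 th : Theta mu th -> 0 < mgf mu th.
Proof.
move=> Tth; rewrite /mgf fine_gt0//.
rewrite lt_neqAle laplace_ge0 andbT -/(Theta mu th) (_ : (_ < _)%E)//.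
rewrite andbT; apply/eqP => /esym l0.
have lap t : laplace mu t = 0%E by exact: laplace_eq0 l0.
have psi0 : psi mu = cst 0.
  by apply/funext => t; rewrite /psi lap /= ln0.
have TT : Theta mu = setT.
  by apply/seteqP; split => // t _; rewrite /Theta /= lap ltry.
have := @psi_inj 0 1; rewrite /T TT interiorT /psi' psi0 !derive1_cst.
by move=> /(_ I I erefl)/eqP; rewrite eq_sym oner_eq0.
Qed.

Lemma expR_psi th : Theta mu th -> expR (psi mu th) = mgf mu th.
Proof. by move=> Tth; rewrite lnK// posrE; exact: mgf_gt0. Qed.

Lemma is_derive_psi th : T th ->
  is_derive th 1 (psi mu) (mgf1 mu th / mgf mu th).
Proof.
move=> Tth; have [s s0 sT] := interior_Theta Tth.
have Tth' : Theta mu th by exact: interior_subset.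
have dm : is_derive th 1 (mgf mu) (mgf1 mu th).
  pose r := s / 2.
  have r0 : 0 < r by rewrite divr_gt0.
  have rs : 2 * r = s by rewrite mulrC divfK.
  apply: (@is_derive_taylor1 _ _ _ _
    (2 / r ^+ 2 * (mgf mu (th + 2 * r) + mgf mu (th - 2 * r))) _ r0) => h hr.
  apply: le_trans (mgf_taylor1 r0 _ _ hr) _.
  - by apply: sT; rewrite rs addrC addKr normrN gtr0_norm.
  - by apply: sT; rewrite rs addrC addKr gtr0_norm.
  - by rewrite expr_div_n le_eqVlt; apply/orP; left; apply/eqP; ring.
rewrite mulrC; apply: (@is_derive1_comp _ (@ln R) (mgf mu)) => //.
exact/is_derive1_ln/mgf_gt0.
Qed.

(** [psi' th] is the mean of the tilted measure, stated without the normalising division. *)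
Lemma mgf1E th : T th -> mgf1 mu th = psi' th * mgf mu th.
Proof.
move=> Tth; have dp := is_derive_psi Tth.
rewrite /psi' derive1E derive_val.
by rewrite divfK// gt_eqF// mgf_gt0//; exact: interior_subset.
Qed.

(* Jensen: integrate the tangent inequality of [expR] at the mean [psi' t]. *)
Lemma psi_tangent s t : T t -> Theta mu s ->
  psi mu t + (s - t) * psi' t <= psi mu s.
Proof.
move=> Tt Ts; have Tt' : Theta mu t by exact: interior_subset.
rewrite -ler_expR (expRD (psi mu t)) (expR_psi Tt') (expR_psi Ts).
have [r r0 rT] := interior_Theta Tt.
have I0 := integrable_expR Tt'.
have I1 : mu.-integrable setT
    (EFin \o (fun x : measurableTypeR R => x * expR (t * x))).
  apply: (integrable_xexpR r0); apply: rT.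
    by rewrite addrC addKr normrN gtr0_norm.
  by rewrite addrC addKr gtr0_norm.
set m := psi' t; pose c := expR ((s - t) * m).
pose a := c * (1 - (s - t) * m); pose b := c * (s - t).
have I0a : mu.-integrable setT
  (EFin \o (fun x : measurableTypeR R => a * expR (t * x))).
  exact: (integrableZl measurableT _ I0).
have I1b : mu.-integrable setT
  (EFin \o (fun x : measurableTypeR R => b * (x * expR (t * x)))).
  exact: (integrableZl measurableT _ I1).
have -> : mgf mu t * c = a * mgf mu t + b * mgf1 mu t.
  by rewrite mgf1E// -/m /a /b; ring.
rewrite /mgf1 -(RintegralZl _ measurableT I1).
rewrite /mgf /laplace -!/(Rintegral mu setT _).
rewrite -(RintegralZl _ measurableT I0) -(RintegralD measurableT I0a I1b).
apply: le_Rintegral => //.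
- exact: (integrableD measurableT I0a I1b).
- exact: integrable_expR.
- move=> x _; have -> : s * x = t * x + (s - t) * m + (s - t) * (x - m) by ring.
  rewrite !expRD -/c (_ : _ + _ = expR (t * x) * c * (1 + (s - t) * (x - m))).
    by rewrite ler_wpM2l ?expR_ge1Dx// mulr_ge0 ?expR_ge0.
  by rewrite /a /b; ring.
Qed.

(** The sum of the tangent inequalities at [s] and at [t]. *)
Lemma psi'_mono s t : T s -> T t -> 0 <= (psi' s - psi' t) * (s - t).
Proof.
move=> Ts Tt; have := psi_tangent Ts (interior_subset Tt).
have := psi_tangent Tt (interior_subset Ts).
move: (psi mu s) (psi mu t) (psi' s) (psi' t) => a b a' b'; lra.
Qed.

Lemma psi'_eq s t : T s -> T t -> (psi' s - psi' t) * (s - t) = 0 -> s = t.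
Proof.
move=> Ts Tt /eqP; rewrite mulf_eq0 !subr_eq0 => /orP[/eqP|/eqP//].
exact: psi_inj.
Qed.

(** Turns bounds on means into bounds on parameters; injectivity excludes the case where [psi'] is
    constant between [t] and [s]. *)
Lemma psi'_le s t : T s -> T t -> psi' s <= psi' t -> s <= t.
Proof.
move=> Ts Tt st; rewrite leNgt; apply/negP => ts.
have := psi'_mono Ts Tt; rewrite pmulr_lge0 ?subr_gt0// subr_ge0 => st'.
have E : psi' s = psi' t.
  by apply/eqP; rewrite eq_le; apply/andP; split; [exact: st|exact: st'].
by move: ts; rewrite (psi_inj Ts Tt E) ltxx.
Qed.

(** The quadratic remainder is divided by [mgf mu th] and absorbed by [1 + x <= expR x]. Uniformity
    in [th] needs an upper bound [U] for the transform at [th + 2 * s] and [th - 2 * s], and a lower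
    bound [l] at [th]. *)
Lemma mgf_subgaussian a b : T a -> T b -> a <= b ->
  exists s K, [/\ 0 < s, 0 < K & forall th h, a <= th <= b -> `|h| <= s ->
    [/\ T th, Theta mu (th + h) & mgf mu (th + h) <=
      mgf mu th * expR (h * psi' th + K * h ^+ 2)]].
Proof.
move=> Ta Tb ab.
have [sa sa0 saT] := interior_Theta Ta; have [sb sb0 sbT] := interior_Theta Tb.
(* Halved so that [a - 2 * s] and [b + 2 * s] still belong to [Theta]. *)
pose s := Num.min sa sb / 2.
have s0 : 0 < s by rewrite divr_gt0// lt_min sa0.
have sE : 2 * s = Num.min sa sb by rewrite mulrC divfK.
have Ta' : Theta mu (a - 2 * s).
  apply: saT; rewrite addrC addKr normrN sE gtr0_norm ?lt_min ?sa0//.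
  by rewrite ge_min lexx.
have Tb' : Theta mu (b + 2 * s).
  apply: sbT; rewrite addrC addKr sE gtr0_norm ?lt_min ?sa0//.
  by rewrite ge_min lexx orbT.
pose U := mgf mu (a - 2 * s) + mgf mu (b + 2 * s).
have U0 : 0 < U by rewrite addr_gt0// mgf_gt0.
(* The tangent of [psi] at [a], at its lowest over [[a, b]]. *)
pose l := expR (psi mu a - (b - a) * `|psi' a|).
have l0 : 0 < l by exact: expR_gt0.
(* Chosen so that [l * (K * h ^+ 2)] equals the remainder bound [2 * (h / s) ^+ 2 * (U + U)]. *)
pose K := 4 * U / (s ^+ 2 * l).
have K0 : 0 < K.
  apply: divr_gt0; apply: mulr_gt0; rewrite ?ltr0n//.
  exact: exprn_gt0.
exists s, K; split; [exact: s0|exact: K0|move=> th h athb hs].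
move: (hs); rewrite ler_norml => hs'.
have Tth : T th by apply: (interior_Theta_between Ta' Tb'); lra.
have Tth' : Theta mu th by exact: interior_subset.
have T1 : Theta mu (th - 2 * s) by apply: (Theta_between Ta' Tb'); lra.
have T2 : Theta mu (th + 2 * s) by apply: (Theta_between Ta' Tb'); lra.
split; [exact: Tth|by apply: (Theta_between T1 T2); lra|].
have lth : l <= mgf mu th.
  rewrite -expR_psi// ler_expR; apply: le_trans (psi_tangent Ta Tth').
  rewrite lerD2l; apply: (@le_trans _ _ (- `|(th - a) * psi' a|)).
    rewrite lerN2 normrM ler_wpM2r ?normr_ge0// ger0_norm; lra.
  by rewrite lerNl -normrN ler_norm.
have m0 : 0 < mgf mu th by exact: mgf_gt0.
have U1 : mgf mu (th + 2 * s) <= U by apply: (mgf_between Ta' Tb'); lra.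
have U2 : mgf mu (th - 2 * s) <= U by apply: (mgf_between Ta' Tb'); lra.
have := mgf_taylor1 s0 T1 T2 hs; rewrite ler_norml => /andP[_].
rewrite lerBlDl lerBlDl mgf1E// => /le_trans; apply.
apply: (@le_trans _ _ (mgf mu th * (1 + (h * psi' th + K * h ^+ 2)))); last first.
  by rewrite ler_pM2l// expR_ge1Dx.
have -> : mgf mu th * (1 + (h * psi' th + K * h ^+ 2)) =
    mgf mu th + (h * (psi' th * mgf mu th) + mgf mu th * (K * h ^+ 2)).
  by move: (mgf mu th) (psi' th) => p q; ring.
rewrite !lerD2l.
apply: (@le_trans _ _ (2 * (h / s) ^+ 2 * (U + U))).
  by rewrite ler_wpM2l ?lerD// mulr_ge0 ?sqr_ge0.
rewrite (_ : 2 * _ * _ = l * (K * h ^+ 2)).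
  by apply: ler_wpM2r => //; rewrite mulr_ge0 ?sqr_ge0 ?ltW.
by rewrite /K; field; rewrite !gt_eqF.
Qed.

End cumulant.

(** * Stationarity and uniqueness of the MLE *)

(* The differences of [f] have zero margins, so they are orthogonal to every
   direct sum, in particular to the difference of the two arguments of [f]. *)
Lemma monotone_margins_eq0 (R : realDomainType) m n (f : R -> R)
    (a a' : 'rV[R]_m) (b b' : 'rV[R]_n) :
  (forall i, \sum_j f (a 0 i + b 0 j) = \sum_j f (a' 0 i + b' 0 j)) ->
  (forall j, \sum_i f (a 0 i + b 0 j) = \sum_i f (a' 0 i + b' 0 j)) ->
  (forall i j, 0 <= (f (a 0 i + b 0 j) - f (a' 0 i + b' 0 j)) *
    ((a 0 i + b 0 j) - (a' 0 i + b' 0 j))) ->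
  forall i j, (f (a 0 i + b 0 j) - f (a' 0 i + b' 0 j)) *
    ((a 0 i + b 0 j) - (a' 0 i + b' 0 j)) = 0.
Proof.
move=> rf cf fge0.
pose D i j := f (a 0 i + b 0 j) - f (a' 0 i + b' 0 j).
have rD i : \sum_j D i j = 0 by rewrite sumrB rf subrr.
have cD j : \sum_i D i j = 0 by rewrite sumrB cf subrr.
have s0 : \sum_i \sum_j D i j * ((a 0 i + b 0 j) - (a' 0 i + b' 0 j)) = 0.
  transitivity (\sum_i \sum_j (D i j * (a 0 i - a' 0 i) +
      D i j * (b 0 j - b' 0 j))).
    by apply: eq_bigr => i _; apply: eq_bigr => j _; ring.
  under eq_bigr do rewrite big_split/= -mulr_suml rD mul0r add0r.
  by rewrite exchange_big/= big1// => j _; rewrite -mulr_suml cD mul0r.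
move=> i j; have s1 k : \sum_l D k l * ((a 0 k + b 0 l) - (a' 0 k + b' 0 l)) = 0.
  by apply: (psumr_eq0P _ s0) => // l _; apply: sumr_ge0 => ? _; exact: fge0.
by apply: (psumr_eq0P _ (s1 i)) => // l _; exact: fge0.
Qed.

Section mle.
Context (R : realType) (mu : {measure set (measurableTypeR R) -> \bar R}).
Hypothesis hmu : regular_base mu.

Let T := (Theta mu)°.
Let psi' := (psi mu)^`()%classic.

(** Fermat's rule at [t = 0], for the dual objective restricted to one coordinate direction. *)
Lemma sum_psi_stationary n (th : 'I_n -> R) (q : R) :
  (forall j, T (th j)) ->
  (forall t, (forall j, T (th j + t)) ->
    t * q - \sum_j psi mu (th j + t) <= - \sum_j psi mu (th j)) ->
  q = \sum_j psi' (th j).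
Proof.
move=> Tth max0.
(* Finitely many open conditions share a neighbourhood of [0], so the maximum is interior. *)
have : \forall t \near (0 : R), forall j, T (th j + t).
  apply: (@filter_forall R 'I_n (fun j t => T (th j + t)) (nbhs (0 : R)) _) => j.
  have cj : {for 0, continuous (fun t : R => th j + t)}.
    by apply: continuousD; [exact: cst_continuous|exact: id].
  apply: (cj T); rewrite addr0; apply: open_nbhs_nbhs; split => //.
  exact: open_interior.
move=> /nbhs_ballP[e /= e0 eT].
pose f t := t * q - \sum_j psi mu (th j + t).
have Te t : t \in `]- e, e[ -> forall j, T (th j + t).
  rewrite in_itv/= => te; apply: eT; rewrite /ball/= sub0r normrN ltr_norml//.
have df t : t \in `]- e, e[ ->
    is_derive t 1 f (q - \sum_j psi' (th j + t)).
  move=> te.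
  have dpsi j : is_derive t 1 (fun u => psi mu (th j + u)) (psi' (th j + t)).
    have d1 := is_derive_psi hmu (Te t te j).
    have -> : psi' (th j + t) = mgf1 mu (th j + t) / mgf mu (th j + t) * 1.
      by rewrite mulr1 /psi' derive1E derive_val.
    apply: (@is_derive1_comp _ (psi mu) (fun u => th j + u)) => //.
    by rewrite -[X in is_derive _ _ _ X]add0r; apply: is_deriveD.
  have -> : f = (fun u => u * q) - \sum_j (fun u => psi mu (th j + u)).
    by apply/funext => u; rewrite /f /= fct_sumE.
  have dsum := @is_derive_sum R R R n (fun j u => psi mu (th j + u)) t 1
    (fun j => psi' (th j + t)) dpsi.
  have dlin : is_derive t 1 (fun u : R => u * q) q.
    apply: is_derive_eq.
    by rewrite scaler0 add0r /GRing.scale /= mulr1.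
  exact: is_deriveB.
have e0' : 0 \in `]- e, e[ by rewrite in_itv/= oppr_lt0 e0.
have ee : - e <= e by lra.
have fmax t : t \in `]- e, e[ -> f t <= f 0.
  move=> te; rewrite /f mul0r sub0r; under [in X in _ <= X]eq_bigr do rewrite addr0.
  by apply: max0; exact: Te.
have d0 := derive1_at_max ee (fun t te => @ex_derive _ _ _ _ _ _ _ (df t te))
  e0' fmax.
have d1 := df 0 e0'.
have /eqP : q - \sum_j psi' (th j + 0) = 0.
  by rewrite -(@derive_val _ _ _ _ _ _ _ d1) (@derive_val _ _ _ _ _ _ _ d0).
rewrite subr_eq0 => /eqP ->.
by apply: eq_bigr => j _; rewrite addr0.
Qed.

(** Exchanging rows and columns derives the column equations from the row equations. *)
Lemma is_MLE_tr m n (r : 'rV[R]_m) (c : 'rV[R]_n) alpha beta :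
  is_MLE mu r c alpha beta -> is_MLE mu c r beta alpha.
Proof.
have dualC (u : 'rV[R]_m) v : dual_obj mu c r v u = dual_obj mu r c u v.
  have E (g : R -> R) : \sum_j \sum_i g (v 0 j + u 0 i) =
      \sum_i \sum_j g (u 0 i + v 0 j).
    rewrite exchange_big/=; apply: eq_bigr => i _; apply: eq_bigr => j _.
    by rewrite addrC.
  by rewrite /dual_obj E [in X in _ = X - _]addrC.
move=> [pot max]; split => [i j|a' b' pot']; first by rewrite addrC.
by rewrite !dualC; apply: max => i j; rewrite addrC.
Qed.

(** Moving [alpha 0 i] alone by [t] adds [t * r 0 i] to the linear part and changes only row [i] of
    the double sum. *)
Lemma MLE_row_sum m n (r : 'rV[R]_m) (c : 'rV[R]_n) alpha beta i :
  is_MLE mu r c alpha beta ->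
  r 0 i = \sum_j psi' (alpha 0 i + beta 0 j).
Proof.
move=> [pot max]; apply: sum_psi_stationary => [j|t Tt]; first exact: pot.
pose alpha' := alpha + t *: delta_mx 0 i.
have a'i k : alpha' 0 k = alpha 0 k + (k == i)%:R * t.
  by rewrite !mxE eqxx/= mulrC.
have pot' : potentials mu alpha' beta.
  move=> k j; rewrite a'i; case: eqP => [->|_].
    by rewrite mul1r addrAC; exact: Tt.
  by rewrite mul0r addr0; exact: pot.
have E1 : \sum_k r 0 k * alpha' 0 k = \sum_k r 0 k * alpha 0 k + t * r 0 i.
  rewrite (bigD1 i)//= [in RHS](bigD1 i)//= a'i eqxx mul1r mulrDr.
  rewrite (eq_bigr (fun k => r 0 k * alpha 0 k)).
    by rewrite -!addrA; congr (_ + _); rewrite addrC mulrC.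
  by move=> k /negbTE ki; rewrite a'i ki mul0r addr0.
have E2 (g : R -> R) : \sum_k \sum_j g (alpha' 0 k + beta 0 j) =
    \sum_j g (alpha 0 i + beta 0 j + t) +
    \sum_(k | k != i) \sum_j g (alpha 0 k + beta 0 j).
  rewrite (bigD1 i)//=; congr (_ + _).
    by apply: eq_bigr => j _; rewrite a'i eqxx mul1r addrAC.
  apply: eq_bigr => k /negbTE ki; apply: eq_bigr => j _.
  by rewrite a'i ki mul0r addr0.
have E3 (g : R -> R) : \sum_k \sum_j g (alpha 0 k + beta 0 j) =
    \sum_j g (alpha 0 i + beta 0 j) +
    \sum_(k | k != i) \sum_j g (alpha 0 k + beta 0 j).
  by rewrite (bigD1 i).
have aux (x y z v w u : R) : x + u + y - (v + z) <= x + y - (w + z) ->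
  u - v <= - w by lra.
by have := max _ _ pot'; rewrite /dual_obj E1 E2 E3 => /aux.
Qed.

Lemma MLE_col_sum m n (r : 'rV[R]_m) (c : 'rV[R]_n) alpha beta j :
  is_MLE mu r c alpha beta ->
  c 0 j = \sum_i psi' (alpha 0 i + beta 0 j).
Proof.
move=> /is_MLE_tr/(MLE_row_sum j) ->.
by apply: eq_bigr => i _; rewrite addrC.
Qed.

(** By stationarity the two mean matrices have the same margins. Only the direct sum can be unique,
    as a constant may pass from [alpha] to [beta]. *)
Lemma MLE_unique m n (r : 'rV[R]_m) (c : 'rV[R]_n) alpha beta alpha' beta' :
  is_MLE mu r c alpha beta -> is_MLE mu r c alpha' beta' ->
  forall i j, alpha 0 i + beta 0 j = alpha' 0 i + beta' 0 j.
Proof.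
move=> h h' i j; apply: (psi'_eq hmu (h.1 i j) (h'.1 i j)).
apply: (@monotone_margins_eq0 _ _ _ psi').
- by move=> k; exact: etrans (esym (MLE_row_sum k h)) (MLE_row_sum k h').
- by move=> l; exact: etrans (esym (MLE_col_sum l h)) (MLE_col_sum l h').
- by move=> k l; exact: (psi'_mono hmu (h.1 k l) (h'.1 k l)).
Qed.

(** If some mean lies in the tame window, both ends of the window lie strictly inside the range of
    [psi'] and are means of parameters [a] and [b]. The other alternative is an empty window,
    possible for large [delta]. *)
Lemma tame_compact (delta : R) : 0 < delta ->
  (exists a b, [/\ T a, T b, a <= b & forall t, T t ->
     (lower_tame mu delta <= (psi' t)%:E <= upper_tame mu delta)%E ->
     a <= t <= b]) \/
  (forall t, T t ->
     ~ (lower_tame mu delta <= (psi' t)%:E <= upper_tame mu delta)%E).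
Proof.
move=> d0.
have [[t0 [Tt0 /andP[lt0 ut0]]]|no] := pselect (exists t, T t /\
  (lower_tame mu delta <= (psi' t)%:E <= upper_tame mu delta)%E); last first.
  by right => t Tt bt; apply: no; exists t.
left; have [_ _ _ [fT _ sT]] := hmu.
have /= /andP[it0 st0] := fT _ Tt0.
have [l El] : exists l : R, lower_tame mu delta = l%:E.
  exists (fine (lower_tame mu delta)); rewrite fineK//.
  rewrite fin_numElt (le_lt_trans lt0) ?ltry// andbT.
  by rewrite /lower_tame lt_max (ltNyr (- delta^-1)) orbT.
have [u Eu] : exists u : R, upper_tame mu delta = u%:E.
  exists (fine (upper_tame mu delta)); rewrite fineK//.
  rewrite fin_numElt (lt_le_trans _ ut0) ?ltNyr//=.
  by rewrite /upper_tame gt_min ltry orbT.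
(* A finite infimum is beaten by the shift [delta], an infinite one by the truncation at
   [- delta^-1]. *)
have il : (inf_supp mu < l%:E)%E.
  rewrite -El /lower_tame lt_max; move: it0.
  case: (inf_supp mu) => [x _|h|_].
  - by rewrite -EFinD lte_fin ltrDl d0.
  - by move: h; rewrite ltNge leey.
  - by apply/orP; right; exact: ltNyr.
have su : (u%:E < sup_supp mu)%E.
  rewrite -Eu /upper_tame gt_min; move: st0.
  case: (sup_supp mu) => [x _|_|h].
  - by rewrite -EFinB lte_fin gtrDl oppr_lt0 d0.
  - by apply/orP; right; exact: ltry.
  - by move: h; rewrite ltNge leNye.
rewrite El in lt0; rewrite Eu in ut0.
have [a Ta /= al] : exists2 a, T a & psi' a = l.
  by apply: sT; rewrite /= il (le_lt_trans lt0).
have [b Tb /= bu] : exists2 b, T b & psi' b = u.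
  by apply: sT; rewrite /= su (lt_le_trans it0).
have ab t : T t -> (l%:E <= (psi' t)%:E <= u%:E)%E -> a <= t <= b.
  rewrite !lee_fin -al -bu => Tt /andP[h1 h2].
  by rewrite (psi'_le hmu Ta Tt h1) (psi'_le hmu Tt Tb h2).
exists a, b; split => //; last by rewrite El Eu.
by have /andP[/le_trans] := ab _ Tt0 (introT andP (conj lt0 ut0)); apply.
Qed.

End mle.

(** * Chernoff bound *)

Lemma prode_le_pow (R : realDomainType) (k : nat) (F : 'I_k -> \bar R) (C : R) :
  (forall a, 0 <= F a <= C%:E)%E -> (\prod_(a < k) F a <= (C ^+ k)%:E)%E.
Proof.
elim: k F => [|k IH] F FC; first by rewrite big_ord0 expr0.
rewrite big_ord_recl exprS EFinM.
have /andP[F0 FC0] := FC ord0.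
apply: lee_pmul => //; last by apply: IH => a; exact: FC.
by apply: prode_ge0 => a _; have /andP[] := FC (lift ord0 a).
Qed.

Section chernoff.
Context (R : realType).
Variable mu : {sigma_finite_measure set (measurableTypeR R) -> \bar R}.

(* Union bound over the [2 ^ p] sign patterns, one of which turns the sum of
   absolute values into a linear functional of the coordinates. *)
Lemma chernoff_tail (k p : nat)
    (M : {sigma_finite_measure set (k.-tuple (measurableTypeR R)) -> \bar R})
    (f : 'I_k -> measurableTypeR R -> R) (q : 'I_k -> R) (cls : 'I_k -> 'I_p)
    (h rho C : R) :
  (M : set _ -> \bar R) = tuple_prod mu (k := k) ->
  (forall a, measurable_fun setT (f a)) -> (forall a x, 0 <= f a x) ->
  0 <= h ->
  (forall a (e : bool),
    \int[mu]_x (f a x * expR ((-1) ^+ e * h * (x - q a)))%:E <= C%:E)%E ->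
  (\int[M]_(t in [set t | (rho <
      \sum_(i < p) `|\sum_(a < k | cls a == i) (tnth t a - q a)|)%R])
      (\prod_(a < k) f a (tnth t a))%:E <=
    (2 ^+ p * (C ^+ k * expR (- (h * rho))))%:E)%E.
Proof.
move=> EM mf f0 h0 fC.
pose g (e : {ffun 'I_p -> bool}) a (x : measurableTypeR R) : R :=
  f a x * expR ((-1) ^+ e (cls a) * h * (x - q a)).
have g0 e a x : 0 <= g e a x by rewrite mulr_ge0 ?expR_ge0.
have mg e a : measurable_fun setT (g e a).
  apply: measurable_funM => //; apply: measurableT_comp => //.
  by apply: measurable_funM => //; exact: measurable_funB.
pose W e (t : k.-tuple (measurableTypeR R)) : R := \prod_(a < k) g e a (tnth t a).
have W0 e t : 0 <= W e t by apply: prodr_ge0.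
have mW e : measurable_fun setT (W e).
  apply: measurable_prod => a _; apply: measurableT_comp => //.
  exact: measurable_tnth.
have IW e : (\int[M]_t (W e t)%:E <= (C ^+ k)%:E)%E.
  rewrite (integral_tuple_prod EM (mg e) (g0 e)); apply: prode_le_pow => a.
  by rewrite fC andbT; apply: integral_ge0 => x _; rewrite lee_fin.
pose D : set (k.-tuple (measurableTypeR R)) := [set t | rho <
  \sum_(i < p) `|\sum_(a < k | cls a == i) (tnth t a - q a)|].
have mD : measurable D.
  have mG : measurable_fun setT (fun t : k.-tuple (measurableTypeR R) =>
      \sum_(i < p) `|\sum_(a < k | cls a == i) (tnth t a - q a)|).
    apply: measurable_sum => i; apply: (measurableT_comp (@normr_measurable R setT)).
    rewrite (_ : (fun t => _) = (fun t : k.-tuple (measurableTypeR R) =>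
      \sum_(a < k) if cls a == i then tnth t a - q a else 0)); last first.
      by apply/funext => t; rewrite big_mkcond.
    apply: measurable_sum => a; case: (cls a == i) => //.
    by apply: measurable_funB => //; exact: measurable_tnth.
  have mrho : measurable_fun setT
    ((fun=> rho) : k.-tuple (measurableTypeR R) -> R) by [].
  have := measurable_fun_ltr mrho mG measurableT (Y := [set true]).
  by rewrite setTI; apply.
have mF : measurable_fun setT (fun t : k.-tuple (measurableTypeR R) =>
    \prod_(a < k) f a (tnth t a)).
  apply: measurable_prod => a _; apply: measurableT_comp => //.
  exact: measurable_tnth.
pose V (t : k.-tuple (measurableTypeR R)) : \bar R :=
  (\sum_e (expR (- (h * rho)))%:E * (W e t)%:E)%E.
have mV : measurable_fun setT V.
  apply: emeasurable_sum => e; apply: measurable_funeM.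
  exact/measurable_EFinP.
have V0 t : (0 <= V t)%E.
  by apply: sume_ge0 => e _; rewrite -EFinM lee_fin mulr_ge0 ?expR_ge0.
have FV t : D t -> ((\prod_(a < k) f a (tnth t a))%:E <= V t)%E.
  move=> Dt.
  pose S i := \sum_(a < k | cls a == i) (tnth t a - q a).
  pose e : {ffun 'I_p -> bool} := [ffun i => S i < 0].
  have WE : W e t = \prod_(a < k) f a (tnth t a) *
      expR (h * \sum_(i < p) `|S i|).
    rewrite /W /g big_split/= -expR_sum; congr (_ * expR _).
    rewrite mulr_sumr (partition_big cls xpredT)//=.
    apply: eq_bigr => i _; rewrite normrEsign mulrA /S mulr_sumr.
    apply: eq_bigr => a /eqP ->; rewrite ffunE; congr (_ * _).
    exact: mulrC.
  rewrite /V (bigD1 e)//=.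
  apply: (@le_trans _ _ ((expR (- (h * rho)))%:E * (W e t)%:E)%E).
    rewrite -EFinM lee_fin WE mulrCA -expRD ler_peMr ?prodr_ge0//.
    rewrite -expR0 ler_expR addrC subr_ge0 ler_wpM2l//.
    exact: ltW.
  rewrite leeDl//; apply: sume_ge0 => e' _.
  by rewrite -EFinM lee_fin mulr_ge0 ?expR_ge0.
apply: (@le_trans _ _ (\int[M]_(t in D) V t)%E).
  apply: ge0_le_integral => //.
  - by move=> t _; rewrite lee_fin prodr_ge0.
  - by apply/measurable_EFinP; exact: measurable_funTS.
  - exact: measurable_funTS.
apply: (@le_trans _ _ (\int[M]_t V t)%E).
  exact: ge0_subset_integral.
rewrite /V ge0_integral_sum//; last 2 first.
- by move=> e; apply: measurable_funeM; exact/measurable_EFinP.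
- by move=> e t _; rewrite -EFinM lee_fin mulr_ge0 ?expR_ge0.
have := card_ffun 'I_p bool; rewrite card_bool card_ord => cardE.
have -> : 2 ^+ p * (C ^+ k * expR (- (h * rho))) =
    \sum_(e : {ffun 'I_p -> bool}) (expR (- (h * rho)) * C ^+ k).
  by rewrite sumr_const cardE -[RHS]mulr_natl natrX [expR _ * _]mulrC.
rewrite -sumEFin; apply: lee_sum => e _.
have mWe : measurable_fun setT (fun t => (W e t)%:E) by exact/measurable_EFinP.
have We0 t : setT t -> (0 <= (W e t)%:E)%E by rewrite lee_fin.
rewrite (ge0_integralZl M measurableT mWe We0) ?lee_fin ?expR_ge0//.
by rewrite EFinM lee_pmul2l ?lte_fin ?expR_gt0.
Qed.

End chernoff.

(** * Exponent budget of the tail bound and the gauge shift *)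

Section numeric.
Context (R : realType).

(** Exponent budget: at most [m] for [2 ^+ m], exactly [K * s ^+ 2 * m] for the moments, and a gain
    of at least [(3 + K * s ^+ 2) * m] from [rho]. What remains is at most [-2 * m <= -2], and
    [expR (- 2) <= 4^-1]. *)
Lemma tail_constant (s K C2 rho : R) (m n : nat) :
  0 < s -> 0 <= K -> 3 + K * s ^+ 2 <= s * C2 -> (0 < m)%N -> (0 < n)%N ->
  C2 * Num.sqrt (m%:R * n%:R * (m%:R + n%:R)) <= rho ->
  2 ^+ m * (expR (K * (s / Num.sqrt n%:R) ^+ 2) ^+ (m * n) *
    expR (- (s / Num.sqrt n%:R * rho))) <= 4^-1.
Proof.
move=> s0 K0 sC2 m0 n0 Hrho.
have n0' : 0 < n%:R :> R by rewrite ltr0n.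
have m1 : 1 <= m%:R :> R by rewrite ler1n.
have q0 : 0 < Num.sqrt n%:R :> R by rewrite sqrtr_gt0.
have q2 : Num.sqrt n%:R ^+ 2 = n%:R :> R by rewrite sqr_sqrtr ?ltW.
set q := Num.sqrt n%:R in q0 q2 *.
have C20 : 0 <= C2.
  rewrite -(pmulr_rge0 _ s0); apply: le_trans sC2.
  by rewrite addr_ge0// mulr_ge0// sqr_ge0.
(* The factor [m + n] is reduced to [m]; the column case reduces it to [n]. *)
have mq : m%:R * q <= Num.sqrt (m%:R * n%:R * (m%:R + n%:R)).
  have mq0 : 0 <= m%:R * q by rewrite mulr_ge0 ?ler0n ?(ltW q0).
  rewrite -(ger0_norm mq0) -sqrtr_sqr ler_wsqrtr// exprMn q2 expr2 -!mulrA.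
  by rewrite ler_wpM2l ?ler0n// mulrC ler_wpM2l ?lerDl ?ler0n.
have hrho : (3 + K * s ^+ 2) * m%:R <= s / q * rho.
  apply: (@le_trans _ _ (s / q * (C2 * (m%:R * q)))); last first.
    apply: ler_wpM2l; first by rewrite divr_ge0 ?(ltW s0) ?(ltW q0).
    apply: le_trans Hrho.
    by rewrite ler_wpM2l.
  rewrite (_ : s / q * _ = s * C2 * m%:R); last by field; rewrite gt_eqF.
  by rewrite ler_wpM2r.
have e1 : 2 <= expR 1 :> R by have := expR_ge1Dx (1 : R); lra.
have E : expR (K * (s / q) ^+ 2) ^+ (m * n) = expR (K * s ^+ 2 * m%:R).
  rewrite -expRM_natr natrM expr_div_n q2; congr expR; field.
  by rewrite gt_eqF.
rewrite E -expRD.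
apply: (@le_trans _ _ (expR (m%:R * 1) * expR (K * s ^+ 2 * m%:R + - (s / q * rho)))).
  by rewrite ler_wpM2r ?expR_ge0// expRM_natl lerXn2r// nnegrE ?expR_ge0.
rewrite -expRD.
apply: (@le_trans _ _ (expR (- (1 + 1)))); first by rewrite ler_expR; lra.
rewrite expRN lef_pV2 ?posrE ?expR_gt0// expRD.
by apply: (@le_trans _ _ (2 * 2)); [lra|apply: ler_pM].
Qed.

(* Only [a + b] is bounded; since [u] and [v] have the same total, the pairing
   is unchanged by [a + t, b - t], and [t = b 0 j0] makes both parts bounded. *)
Lemma direct_sum_pairing_le (m n : nat) (a u : 'rV[R]_m) (b v : 'rV[R]_n)
    (C rho : R) : (0 < m)%N -> (0 < n)%N ->
  (forall i j, `|a 0 i + b 0 j| <= C) ->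
  \sum_i u 0 i = \sum_j v 0 j -> l1norm u <= rho -> l1norm v <= rho ->
  `|\sum_i a 0 i * u 0 i + \sum_j b 0 j * v 0 j| <= 3 * C * rho.
Proof.
move=> m0 n0 abC uv urho vrho.
pose i0 := Ordinal m0; pose j0 := Ordinal n0; pose t := b 0 j0.
have C0 : 0 <= C by apply: le_trans (abC i0 j0).
have bound p (w z : 'rV[R]_p) (D : R) : 0 <= D ->
    (forall i, `|w 0 i| <= D) -> l1norm z <= rho ->
    `|\sum_i w 0 i * z 0 i| <= D * rho.
  move=> D0 wD zrho; apply: le_trans (ler_norm_sum _ _ _) _.
  apply: (@le_trans _ _ (D * l1norm z)); last by rewrite ler_wpM2l.
  rewrite /l1norm mulr_sumr; apply: ler_sum => i _.
  by rewrite normrM ler_wpM2r.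
have -> : \sum_i a 0 i * u 0 i + \sum_j b 0 j * v 0 j =
    \sum_i (a + const_mx t) 0 i * u 0 i + \sum_j (b - const_mx t) 0 j * v 0 j.
  under [X in _ = X + _]eq_bigr do rewrite !mxE mulrDl.
  under [X in _ = _ + X]eq_bigr do rewrite !mxE mulrBl.
  rewrite big_split sumrB/= -!mulr_sumr uv.
  by rewrite addrACA -[LHS]addr0; congr (_ + _); rewrite subrr.
apply: le_trans (ler_normD _ _) _.
(* The shifted [a] has entries [a i + b j0], bounded by [C]; the shifted [b] has differences of two
   such sums in row [i0], bounded by [2 * C]. *)
rewrite (_ : 3 * C * rho = C * rho + 2 * C * rho); last by ring.
apply: lerD; apply: bound => //.
- by move=> i; rewrite !mxE; exact: abC.
- by rewrite mulr_ge0.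
- move=> j; rewrite !mxE (_ : b 0 j - t = (a 0 i0 + b 0 j) - (a 0 i0 + t)).
    by rewrite mulr_natl mulr2n; apply: le_trans (ler_normB _ _) _;
      apply: lerD; exact: abC.
  by ring.
Qed.

End numeric.

(** * Transportation sets *)

Section mxvec_classes.
Context (R : realType) (m n : nat).

(** The row and the column of a flat index are the class maps [cls] to which the tail bound is
    applied. *)
Lemma mxvec_index_inv :
  exists (row : 'I_(m * n) -> 'I_m) (col : 'I_(m * n) -> 'I_n),
  forall i j, row (mxvec_index i j) = i /\ col (mxvec_index i j) = j.
Proof.
have [g gK _] := curry_mxvec_bij m n.
exists (fun a => (g a).1), (fun a => (g a).2) => i j.
by have := gK (i, j) => /= ->.
Qed.

Variables (row : 'I_(m * n) -> 'I_m) (col : 'I_(m * n) -> 'I_n).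
Hypothesis rcE :
  forall i j, row (mxvec_index i j) = i /\ col (mxvec_index i j) = j.

Lemma sum_row_class (F : 'I_(m * n) -> R) i :
  \sum_(a | row a == i) F a = \sum_j F (mxvec_index i j).
Proof.
rewrite big_mkcond big_mxvec_index (bigD1 i)//= [X in _ + X]big1 ?addr0.
  by apply: eq_bigr => j _; rewrite (rcE i j).1 eqxx.
by move=> k /negbTE ki; rewrite big1// => j _; rewrite (rcE k j).1 ki.
Qed.

Lemma sum_col_class (F : 'I_(m * n) -> R) j :
  \sum_(a | col a == j) F a = \sum_i F (mxvec_index i j).
Proof.
rewrite big_mkcond big_mxvec_index; apply: eq_bigr => i _.
rewrite (bigD1 j)//= (rcE i j).2 eqxx [X in _ + X]big1 ?addr0//.
by move=> k /negbTE kj; rewrite (rcE i k).2 kj.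
Qed.

Lemma row_transport_tuple (q : 'I_(m * n) -> R) (r : 'rV[R]_m) (rho : R) :
  (forall i, r 0 i = \sum_j q (mxvec_index i j)) ->
  @mx_of_tuple R m n @^-1` (~` [set x | l1norm (row_sums x - r) <= rho]) =
  [set t | rho < \sum_(i < m) `|\sum_(a | row a == i) (tnth t a - q a)|].
Proof.
move=> rq; apply/funext => t; rewrite /preimage /setC /=.
rewrite (_ : l1norm _ = \sum_(i < m) `|\sum_(a | row a == i) (tnth t a - q a)|).
  by rewrite ltNge; apply/propext; split => /negP.
apply: eq_bigr => i _; rewrite sum_row_class sumrB -rq !mxE.
by congr (`|_ - _|); apply: eq_bigr => j _; rewrite mxE.
Qed.

Lemma col_transport_tuple (q : 'I_(m * n) -> R) (c : 'rV[R]_n) (rho : R) :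
  (forall j, c 0 j = \sum_i q (mxvec_index i j)) ->
  @mx_of_tuple R m n @^-1` (~` [set x | l1norm (col_sums x - c) <= rho]) =
  [set t | rho < \sum_(j < n) `|\sum_(a | col a == j) (tnth t a - q a)|].
Proof.
move=> cq; apply/funext => t; rewrite /preimage /setC /=.
rewrite (_ : l1norm _ = \sum_(j < n) `|\sum_(a | col a == j) (tnth t a - q a)|).
  by rewrite ltNge; apply/propext; split => /negP.
apply: eq_bigr => j _; rewrite sum_col_class sumrB -cq !mxE.
by congr (`|_ - _|); apply: eq_bigr => i _; rewrite mxE.
Qed.

End mxvec_classes.

Section transport_bounds.
Context (R : realType).
Variable mu : {sigma_finite_measure set (measurableTypeR R) -> \bar R}.

Lemma tilted_densityE m n (r : 'rV[R]_m) (c : 'rV[R]_n) alpha beta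
    (t : (m * n).-tuple (measurableTypeR R)) :
  tilted_density mu (potential_row alpha beta) t =
  expR (dual_obj mu r c alpha beta +
    (\sum_i alpha 0 i * (row_sums (mx_of_tuple t) - r) 0 i +
     \sum_j beta 0 j * (col_sums (mx_of_tuple t) - c) 0 j)).
Proof.
rewrite /tilted_density -expR_sum big_mxvec_index /dual_obj; congr expR.
move: (psi mu) => g.
pose x := mx_of_tuple t : 'M[R]_(m, n).
transitivity (\sum_i \sum_j (alpha 0 i * x i j + beta 0 j * x i j -
    g (alpha 0 i + beta 0 j))).
  by apply: eq_bigr => i _; apply: eq_bigr => j _;
    rewrite potential_rowE /x mxE mulrDl.
have E1 : \sum_i alpha 0 i * (row_sums x - r) 0 i =
    \sum_i \sum_j alpha 0 i * x i j - \sum_i r 0 i * alpha 0 i.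
  rewrite -sumrB; apply: eq_bigr => i _; rewrite !mxE mulrBr mulr_sumr.
  by rewrite (mulrC (r 0 i)).
have E2 : \sum_j beta 0 j * (col_sums x - c) 0 j =
    \sum_i \sum_j beta 0 j * x i j - \sum_j c 0 j * beta 0 j.
  rewrite exchange_big -sumrB; apply: eq_bigr => j _; rewrite !mxE mulrBr.
  by rewrite mulr_sumr (mulrC (c 0 j)).
rewrite E1 E2; under eq_bigr do rewrite sumrB big_split/=.
rewrite sumrB big_split/=.
have aux (A B C D E : R) : A + B - E = C + D - E + (A - C + (B - D)) by ring.
exact: aux.
Qed.

(** With [p = psi mu th] and [q] the tilted mean, the normalisation and the centring cancel, leaving
    only the Gaussian factor. *)
Lemma integral_tilted_expR (th h p q K : R) :
  Theta mu (th + h) -> mgf mu (th + h) <= expR p * expR (h * q + K * h ^+ 2) ->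
  (\int[mu]_x (expR (th * x - p) * expR (h * (x - q)))%:E <=
    (expR (K * h ^+ 2))%:E)%E.
Proof.
move=> Th mgfh.
have E (x : R) : expR (th * x - p) * expR (h * (x - q)) =
    expR (- p - h * q) * expR ((th + h) * x).
  by rewrite -!expRD; congr expR; ring.
under eq_integral do rewrite E EFinM.
have me : measurable_fun setT
    (EFin \o (fun x : measurableTypeR R => expR ((th + h) * x))).
  by apply/measurable_EFinP; exact: measurable_expRM.
have e0 (x : measurableTypeR R) : setT x -> (0 <= (expR ((th + h) * x))%:E)%E.
  by move=> _; rewrite lee_fin expR_ge0.
have c0 : (0 <= (expR (- p - h * q))%:E)%E by rewrite lee_fin expR_ge0.
rewrite (ge0_integralZl mu measurableT me e0 c0).
have -> : (\int[mu]_x (expR ((th + h) * x))%:E)%E = (mgf mu (th + h))%:E.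
  by rewrite /mgf fineK// ge0_fin_numE// laplace_ge0.
rewrite -EFinM lee_fin.
apply: le_trans (ler_wpM2l (expR_ge0 _) mgfh) _.
by rewrite -!expRD ler_expR; lra.
Qed.

Hypothesis hmu : regular_base mu.
Variables a b s K : R.
Hypothesis s0 : 0 < s.
Hypothesis K0 : 0 <= K.
Hypothesis sub_ab : forall th h, a <= th <= b -> `|h| <= s ->
  [/\ (Theta mu)° th, Theta mu (th + h) & mgf mu (th + h) <=
    mgf mu th * expR (h * (psi mu)^`()%classic th + K * h ^+ 2)].

Lemma tilted_density_tail k p
    (M : {sigma_finite_measure set (k.-tuple (measurableTypeR R)) -> \bar R})
    (th : 'rV[R]_k) (cls : 'I_k -> 'I_p) (h rho : R) :
  (M : set _ -> \bar R) = tuple_prod mu (k := k) ->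
  (forall i, a <= th 0 i <= b) -> 0 <= h <= s ->
  (\int[M]_(t in [set t | (rho < \sum_(i < p) `|\sum_(l < k | cls l == i)
       (tnth t l - (psi mu)^`()%classic (th 0%R l))|)%R])
     (tilted_density mu th t)%:E <=
   (2 ^+ p * (expR (K * h ^+ 2) ^+ k * expR (- (h * rho))))%:E)%E.
Proof.
move=> EM thab /andP[h0 hs].
apply: (@chernoff_tail _ mu k p M
  (fun l x => expR (th 0 l * x - psi mu (th 0 l)))
  (fun l => (psi mu)^`()%classic (th 0 l))) => //.
- move=> l; apply: measurableT_comp => //.
  by apply: measurable_funB => //; exact: measurable_funM.
- move=> l e.
  have hn : `|(-1) ^+ e * h| <= s by rewrite normrMsign ger0_norm.
  have h2 : ((-1) ^+ e * h) ^+ 2 = h ^+ 2 by rewrite exprMn sqrr_sign mul1r.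
  have [Tl Tlh mh] := sub_ab (thab l) hn.
  rewrite -h2; apply: integral_tilted_expR => //.
  by rewrite expR_psi//; exact: interior_subset.
Qed.

End transport_bounds.

(** * Probability that the tilted matrix meets the margin constraints *)

Section half.
Context (R : realType).
Variable mu : {sigma_finite_measure set (measurableTypeR R) -> \bar R}.
Hypothesis hmu : regular_base mu.
Context (m n : nat) (d : measure_display) (Omega : measurableType d).
Variables (P : probability Omega R) (Y : {RV P >-> borelmx R m n}).
Variables (r : 'rV[R]_m) (c : 'rV[R]_n) (alpha : 'rV[R]_m) (beta : 'rV[R]_n).
Hypothesis mle : is_MLE mu r c alpha beta.
Hypothesis lawY : tilted_matrix Y mu alpha beta.

Lemma measurable_preimage_RV (E : set (borelmx R m n)) :
  measurable E -> measurable (Y @^-1` E).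
Proof. by move=> mE; rewrite -[_ @^-1` _]setTI; exact: measurable_funP. Qed.

(** Row and column constraints each fail with probability at most [1 / 4]. The column estimate is
    the row estimate with [m] and [n] exchanged; positivity of both keeps the parameters
    [s / sqrt n] and [s / sqrt m] at most [s]. *)
Lemma transport_prob_ge_half (a b s K C2 rho : R) :
  0 < s -> 0 <= K ->
  (forall th h, a <= th <= b -> `|h| <= s ->
  [/\ (Theta mu)° th, Theta mu (th + h) & mgf mu (th + h) <=
    mgf mu th * expR (h * (psi mu)^`()%classic th + K * h ^+ 2)]) ->
  (forall i j, a <= alpha 0 i + beta 0 j <= b) ->
  3 + K * s ^+ 2 <= s * C2 -> (0 < m)%N -> (0 < n)%N ->
  C2 * Num.sqrt (m%:R * n%:R * (m%:R + n%:R)) <= rho ->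
  (2^-1%:E <= P (Y @^-1` transport rho r c))%E.
Proof.
move=> s0 K0 Hsub thab sC2 m0 n0 Hrho.
have [M EM] := tuple_prod_measure mu (m * n)%N.
have [row [col rcE]] := mxvec_index_inv m n.
pose th := potential_row alpha beta.
pose q l := (psi mu)^`()%classic (th 0 l).
have rq i : r 0 i = \sum_j q (mxvec_index i j).
  rewrite (MLE_row_sum hmu i mle); apply: eq_bigr => j _.
  by rewrite /q /th potential_rowE.
have cq j : c 0 j = \sum_i q (mxvec_index i j).
  rewrite (MLE_col_sum hmu j mle); apply: eq_bigr => i _.
  by rewrite /q /th potential_rowE.
have thab' l : a <= th 0 l <= b.
  by case/mxvec_indexP: l => i j; rewrite /th potential_rowE.
have hbound k : (0 < k)%N -> 0 <= s / Num.sqrt k%:R <= s.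
  move=> k0; have sk : 1 <= Num.sqrt k%:R :> R.
    by rewrite -[leLHS]sqrtr1 ler_wsqrtr// ler1n.
  rewrite divr_ge0 ?sqrtr_ge0 ?(ltW s0)//=.
  by rewrite ler_pdivrMr ?(lt_le_trans ltr01)// ler_peMr// ltW.
pose Er : set (borelmx R m n) := [set x | l1norm (row_sums x - r) <= rho].
pose Ec : set (borelmx R m n) := [set x | l1norm (col_sums x - c) <= rho].
have mEr : measurable Er by exact: measurable_row_transport.
have mEc : measurable Ec by exact: measurable_col_transport.
have Pr : (P (Y @^-1` (~` Er)) <= (4^-1)%:E)%E.
  rewrite (tilted_matrix_law EM lawY (measurableC mEr)).
  rewrite (row_transport_tuple rcE rho rq).
  apply: le_trans (tilted_density_tail hmu Hsub row rho EM thab' (hbound n n0)) _.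
  rewrite lee_fin; exact: (tail_constant s0 K0 sC2 m0 n0 Hrho).
have Pc : (P (Y @^-1` (~` Ec)) <= (4^-1)%:E)%E.
  rewrite (tilted_matrix_law EM lawY (measurableC mEc)).
  rewrite (col_transport_tuple rcE rho cq).
  apply: le_trans (tilted_density_tail hmu Hsub col rho EM thab' (hbound m m0)) _.
  rewrite lee_fin mulnC; apply: (tail_constant s0 K0 sC2 n0 m0).
  by rewrite (mulrC n%:R) (addrC n%:R).
have mT : measurable (Y @^-1` transport rho r c).
  exact: measurable_preimage_RV (measurable_transport _ _ _).
have TE : ~` (Y @^-1` transport rho r c) = Y @^-1` (~` Er) `|` Y @^-1` (~` Ec).
  by rewrite preimage_setC -preimage_setU -setCI.
have PTC : (P (~` (Y @^-1` transport rho r c)) <= (2^-1)%:E)%E.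
  rewrite TE; apply: le_trans.
    apply: measureU2; apply: measurable_preimage_RV; exact: measurableC.
  apply: le_trans (leeD Pr Pc) _; rewrite -EFinD lee_fin; lra.
rewrite -[X in P X]setCK probability_setC; last exact: measurableC.
move: PTC; have : P (~` (Y @^-1` transport rho r c)) \is a fin_num.
  by apply: fin_num_measure; exact: measurableC.
by case: (P _) => //= x _; rewrite !lee_fin; lra.
Qed.

End half.

(** * Conditioned law against tilted law *)

Section density_comparison.
Context (R : realType).
Variable mu : {sigma_finite_measure set (measurableTypeR R) -> \bar R}.
Context (m n : nat) (d : measure_display) (Omega : measurableType d).
Variables (P : probability Omega R) (Y : {RV P >-> borelmx R m n}).
Variables (alpha : 'rV[R]_m) (beta : 'rV[R]_n).
Hypothesis lawY : tilted_matrix Y mu alpha beta.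
Variables (T : set (borelmx R m n)) (D L : R).
Hypothesis mT : measurable T.
Hypothesis density_T : forall t, T (mx_of_tuple t) ->
  expR (D - L) <= tilted_density mu (potential_row alpha beta) t <= expR (D + L).

Lemma tilted_matrix_ge (E : set (borelmx R m n)) : measurable E -> E `<=` T ->
  ((expR (D - L))%:E * mx_prod mu E <= P (Y @^-1` E))%E.
Proof.
move=> mE ET.
have [M EM] := tuple_prod_measure mu (m * n)%N.
have mxE' : measurable (@mx_of_tuple R m n @^-1` E).
  by rewrite -[X in measurable X]setTI; exact: measurable_mx_of_tuple.
rewrite (tilted_matrix_law EM lawY mE) /mx_prod /pushforward -EM.
rewrite -integral_cst//; apply: ge0_le_integral => //.
- by move=> t _; rewrite lee_fin expR_ge0.
- by apply/measurable_EFinP; apply: measurable_funTS;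
    exact: measurable_tilted_density.
- by move=> t Et; rewrite lee_fin; have /andP[] := density_T (ET _ Et).
Qed.

Lemma tilted_matrix_le :
  (P (Y @^-1` T) <= (expR (D + L))%:E * mx_prod mu T)%E.
Proof.
have [M EM] := tuple_prod_measure mu (m * n)%N.
have mxE' : measurable (@mx_of_tuple R m n @^-1` T).
  by rewrite -[X in measurable X]setTI; exact: measurable_mx_of_tuple.
rewrite (tilted_matrix_law EM lawY mT) /mx_prod /pushforward -EM.
rewrite -integral_cst//; apply: ge0_le_integral => //.
- by move=> t _; rewrite lee_fin ltW// tilted_density_gt0.
- by apply/measurable_EFinP; apply: measurable_funTS;
    exact: measurable_tilted_density.
- by move=> t Tt; rewrite lee_fin; have /andP[] := density_T Tt.
Qed.

Lemma mx_prodS (E : set (borelmx R m n)) : measurable E -> E `<=` T ->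
  (0 <= mx_prod mu E <= mx_prod mu T)%E.
Proof.
move=> mE ET.
have [M EM] := tuple_prod_measure mu (m * n)%N.
rewrite /mx_prod /pushforward -EM measure_ge0/=.
have mpre (A : set (borelmx R m n)) : measurable A ->
    measurable (@mx_of_tuple R m n @^-1` A).
  by move=> mA; rewrite -[X in measurable X]setTI; exact: measurable_mx_of_tuple.
apply: le_measure; rewrite ?inE; [exact: mpre|exact: mpre|].
by move=> t; exact: ET.
Qed.

Lemma conditioned_le (E : set (borelmx R m n)) : measurable E ->
  (0 < mx_prod mu T < +oo)%E ->
  (0 < P (Y @^-1` T))%E /\
  (mx_prod mu (E `&` T) / mx_prod mu T <=
    (expR (2 * L))%:E * (P (Y @^-1` T))^-1 * P (Y @^-1` E))%E.
Proof.
move=> mE /andP[T0 Too].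
have mET : measurable (E `&` T) by exact: measurableI.
have ge_ET := tilted_matrix_ge mET (@subIsetr _ _ _).
have ge_T := tilted_matrix_ge mT (@subset_refl _ _).
have le_T := tilted_matrix_le.
have /andP[ET0 ETT] := mx_prodS mET (@subIsetr _ _ _).
have PE : (P (Y @^-1` (E `&` T)) <= P (Y @^-1` E))%E.
  apply: le_measure; rewrite ?inE; [|exact: measurable_preimage_RV|].
    exact: (measurable_preimage_RV Y mET).
  by move=> w [].
have fP (A : set (borelmx R m n)) : measurable A -> P (Y @^-1` A) \is a fin_num.
  by move=> mA; apply: fin_num_measure; exact: measurable_preimage_RV.
move: T0 Too ge_ET ge_T le_T ET0 ETT PE (fP _ mE) (fP _ mT) (fP _ mET).
case: (mx_prod mu T) => [tT| |]//; case: (mx_prod mu (E `&` T)) => [tE| |]//.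
case: (P (Y @^-1` T)) => [pT| |]//; case: (P (Y @^-1` E)) => [pE| |]//.
case: (P (Y @^-1` (E `&` T))) => [pET| |]//.
rewrite -!EFinM !lee_fin !lte_fin => T0 _ ge_ET ge_T le_T E0 _ PE _ _ _.
have pT0 : 0 < pT by apply: lt_le_trans ge_T; rewrite mulr_gt0 ?expR_gt0.
split => //.
rewrite !inver !gt_eqF// -!EFinM lee_fin.
rewrite ler_pdivrMr//.
apply: (@le_trans _ _ (pET / expR (D - L))).
  by rewrite ler_pdivlMr ?expR_gt0// mulrC.
apply: (@le_trans _ _ (pE / expR (D - L))).
  by rewrite ler_wpM2r// invr_ge0 expR_ge0.
have pE0 : 0 <= pE.
  by apply: le_trans PE; apply: le_trans ge_ET; rewrite mulr_ge0 ?expR_ge0.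
rewrite [leRHS](_ : _ = pE * (expR (2 * L) * (tT / pT))); last by ring.
rewrite ler_wpM2l// -expRN.
have -> : expR (- (D - L)) = expR (2 * L) / expR (D + L).
  by rewrite -expRN -expRD; congr expR; ring.
rewrite ler_wpM2l ?expR_ge0// ler_pdivlMr// mulrC ler_pdivrMr ?expR_gt0//.
by rewrite mulrC.
Qed.

End density_comparison.

(** * Choice of the constants and the two inequalities *)

Theorem theorem1p10 (R : realType)
    (mu : {sigma_finite_measure set (measurableTypeR R) -> \bar R})
    (hmu : regular_base mu) (delta : R) (hdelta : 0 < delta) :
  exists C1 C2 : R, [/\ 0 < C1, 0 < C2 &
    forall (m n : nat) (r : 'rV[R]_m) (c : 'rV[R]_n)
      (alpha : 'rV[R]_m) (beta : 'rV[R]_n) (rho : R)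
      (dX dY : measure_display)
      (OmegaX : measurableType dX) (OmegaY : measurableType dY)
      (PX : probability OmegaX R) (PY : probability OmegaY R)
      (X : {RV PX >-> borelmx R m n}) (Y : {RV PY >-> borelmx R m n}),
    (0 < m)%N -> (0 < n)%N ->
    tame mu delta r c -> is_MLE mu r c alpha beta -> 0 <= rho ->
    (0 < mx_prod mu (transport rho r c : set (borelmx R m n)) < +oo)%E ->
    has_law X (lambda mu rho r c) ->
    tilted_matrix Y mu alpha beta ->
    forall E : set (borelmx R m n), measurable E ->
      (PX (X @^-1` E) <=
         (expR (C1 * rho))%:E * (PY (Y @^-1` transport rho r c))^-1
           * PY (Y @^-1` E))%E /\
      (C2 * Num.sqrt (m%:R * n%:R * (m%:R + n%:R)) <= rho ->
       C2 <= m%:R -> C2 <= n%:R ->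
       (PX (X @^-1` E) <= (2 * expR (C1 * rho))%:E * PY (Y @^-1` E))%E)].
Proof.
have [[a [b [Ta Tb ab tame_ab]]]|no] := tame_compact hmu hdelta; last first.
  (* With an empty tame window no matrix with an entry has a tame margin, so any constants do. *)
  exists 1, 1; split => // m n r c alpha beta rho dX dY OmegaX OmegaY PX PY X Y.
  move=> m0 n0 [alpha0 [beta0 [mle0 bd0]]].
  have [] := no _ (mle0.1 (Ordinal m0) (Ordinal n0)); exact: bd0.
have [s [K [s0 K0 Hsub]]] := mgf_subgaussian hmu Ta Tb ab.
pose C := `|a| + `|b|; have C0 : 0 <= C by rewrite addr_ge0.
(* [6 * C] is twice the constant [3 * C] of the gauge bound, and [+ 1] keeps [C1] positive when
   [C = 0]. The second constant solves [s * C2 = 3 + K * s ^+ 2]. *)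
exists (6 * C + 1), ((3 + K * s ^+ 2) / s); split.
- by rewrite ltr_wpDl// mulr_ge0.
- by rewrite divr_gt0// ltr_wpDr// mulr_ge0 ?sqr_ge0// ltW.
move=> m n r c alpha beta rho dX dY OmegaX OmegaY PX PY X Y m0 n0.
move=> [alpha0 [beta0 [mle0 bd0]]] mle rho0 Tpos lawX lawY E mE.
(* Tameness bounds the means of some MLE, which need not be the given one. *)
have thab i j : a <= alpha 0 i + beta 0 j <= b.
  rewrite (MLE_unique hmu mle mle0); apply: tame_ab (bd0 i j).
  exact: mle0.1.
have thC i j : `|alpha 0 i + beta 0 j| <= C.
  have /andP[h1 h2] := thab i j; rewrite ler_norml /C.
  have := ler_norm b; have := ler_norm (- a); rewrite normrN.
  by have := normr_ge0 a; have := normr_ge0 b; lra.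
(* Both totals are the sum of all entry means; hence the row and column deviations of a matrix have
   equal totals, as the gauge shift requires. *)
have rcE : \sum_i r 0 i = \sum_j c 0 j.
  under eq_bigr do rewrite (MLE_row_sum hmu _ mle).
  by rewrite exchange_big; apply: eq_bigr => j _; rewrite -(MLE_col_sum hmu _ mle).
have dens t : transport rho r c (mx_of_tuple t) ->
    expR (dual_obj mu r c alpha beta - 3 * C * rho) <=
    tilted_density mu (potential_row alpha beta) t <=
    expR (dual_obj mu r c alpha beta + 3 * C * rho).
  move=> [hr hc]; rewrite (tilted_densityE mu r c) !ler_expR !lerD2l.
  rewrite -ler_norml; apply: direct_sum_pairing_le => //.
  under eq_bigr do rewrite !mxE.
  under [RHS]eq_bigr do rewrite !mxE.
  by rewrite !sumrB rcE exchange_big.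
have mT := measurable_transport rho r c.
have [PT0 main] := conditioned_le lawY mT dens mE Tpos.
have XE : PX (X @^-1` E) = lambda mu rho r c E by exact: lawX.
have C1rho : 2 * (3 * C * rho) <= (6 * C + 1) * rho by nra.
have PE0 : (0 <= PY (Y @^-1` E))%E by exact: measure_ge0.
have main' : (PX (X @^-1` E) <= (expR ((6 * C + 1) * rho))%:E *
    (PY (Y @^-1` transport rho r c))^-1 * PY (Y @^-1` E))%E.
  rewrite XE; apply: le_trans main _.
  apply: lee_wpmul2r => //; apply: lee_wpmul2r; first by rewrite inve_ge0 ltW.
  by rewrite lee_fin ler_expR.
split => // Hrho _ _; apply: le_trans main' _.
have half : (2^-1%:E <= PY (Y @^-1` transport rho r c))%E.
  apply: (transport_prob_ge_half hmu mle lawY s0 (ltW K0) Hsub thab _ m0 n0 Hrho).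
  by rewrite [leRHS]mulrC divfK ?gt_eqF.
apply: lee_wpmul2r => //; rewrite muleC EFinM.
apply: lee_wpmul2r; first by rewrite lee_fin expR_ge0.
rewrite inve_ple ?inE ?lee_fin// ?(ltW PT0)//.
by rewrite inver gt_eqF.
Qed.
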